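(* Let $g>0$, $k>0$, $\eta\in\mathbb{R}$ be constants, let $b=b(\mathbf{x})$ be a given time-independent bottom topography, fix the parameter $\Delta x>0$ and for $\varepsilon>0$ set $\mu(\varepsilon)=e^{-\varepsilon^2/\Delta x}$ (so $\mu(0)=1$). Put $U=(h,\mathbf{q})^T$, $H=h+b$, $\gamma=gk^2|\mathbf{q}|/h^{\eta}$ and $$F(U)=\begin{pmatrix}-\nabla\cdot\mathbf{q}-\mu(\varepsilon)\nabla\cdot\left(\sqrt{\frac{h^{\eta+1}}{k^2}}\frac{\nabla H}{\sqrt{|\nabla H|}}\right)\\[2mm] -\nabla\cdot\left(\frac{\mathbf{q}\otimes\mathbf{q}}{h}\right)\end{pmatrix},\qquad G(U)=\begin{pmatrix}\mu(\varepsilon)\nabla\cdot\left(\sqrt{\frac{h^{\eta+1}}{k^2}}\frac{\nabla H}{\sqrt{|\nabla H|}}\right)\\[2mm] -\frac1{\varepsilon^2}\nabla\left(\frac g2h^2\right)-\frac1{\varepsilon^2}gh\nabla b-\frac1{\varepsilon^2}\gamma\mathbf{q}\end{pmatrix}.$$ Consider an $s$-stage implicit-explicit (IMEX) Runge-Kutta scheme of order $p$, with coefficients $(\tilde A,\tilde{\mathbf b},\tilde{\mathbf c})$ (explicit) and $(A,\mathbf b,\mathbf c)$ (diagonally implicit), applied with time step $\Delta t$ to $U_t=F(U)+G(U)$, semi-discretely in time with space kept continuous: for $i=1,\dots,s$, $$U^{(i)}=U^n+\Delta t\sum_{j=1}^{i-1}\tilde a_{ij}F(U^{(j)})+\Delta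 t\sum_{j=1}^{i}a_{ij}G(U^{(j)}),$$ $$U^{n+1}=U^n+\Delta t\sum_{i=1}^{s}\tilde b_iF(U^{(i)})+\Delta t\sum_{i=1}^{s}b_iG(U^{(i)}).$$ Assume that the IMEX Runge-Kutta method is globally stiffly accurate (GSA) and that the initial conditions are well-prepared. Denote by $\mathbf{U}^1(\mathbf{x};\varepsilon)=(h^1(\mathbf{x};\varepsilon),\mathbf{q}^1(\mathbf{x};\varepsilon))^T$ the numerical solution after one time step and by $\mathbf{U}^{exa}(\mathbf{x},t)=(h^{exa}(\mathbf{x},t),\mathbf{q}^{exa}(\mathbf{x},t))^T$ the exact solution of the limiting equation. Then $$\lim_{\varepsilon\to0}\mathbf{U}^1(\mathbf{x};\varepsilon)=\mathbf{U}^{exa}(\mathbf{x},\Delta t)+\mathcal{O}(\Delta t^{p+1}),$$ i.e. the scheme is asymptotically accurate.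
   Context: The system $U_t=F(U)+G(U)$ is a rewriting of the scaled shallow water equations with Manning friction $$\partial_t h+\nabla\cdot\mathbf{q}=0,\qquad \partial_t\mathbf{q}+\nabla\cdot\left(\frac{\mathbf{q}\otimes\mathbf{q}}{h}\right)+\frac{1}{\varepsilon^2}\nabla\left(\frac g2h^2\right)=-\frac1{\varepsilon^2}gh\nabla b-\frac1{\varepsilon^2}\gamma\mathbf{q},$$ where $h>0$ is the water depth, $\mathbf{q}$ the (vector-valued) momentum, $|\cdot|$ the Euclidean norm, and $H=h+b$ the surface level. The quantity $\nabla H/\sqrt{|\nabla H|}$ is understood to be $0$ where $\nabla H=0$. IMEX Runge-Kutta coefficients: $\tilde A=(\tilde a_{ij})$ is an $s\times s$ matrix with $\tilde a_{ij}=0$ for $j\ge i$; $A=(a_{ij})$ is an $s\times s$ matrix with $a_{ij}=0$ for $j>i$; $\tilde{\mathbf b},\mathbf b\in\mathbb{R}^s$; $\tilde c_i=\sum_{j=1}^{i-1}\tilde a_{ij}$ and $c_i=\sum_{j=1}^{i}a_{ij}$. Order $p$ is the usual (classical) order of the additive Runge-Kutta method. The method is globally stiffly accurate (GSA) if $\tilde{\mathbf b}^T=\mathbf e_s^T\tilde A$ and $\mathbf b^T=\mathbf e_s^TA$ with $\mathbf e_s=(0,\dots,0,1)^T$. Limiting equation: $$\partial_t h_0=\nabla\cdot\left(\sqrt{\frac{h_0^{\eta+1}}{k^2}}\frac{\nabla H_0}{\sqrt{|\nabla H_0|}}\right),\qquad H_0=h_0+b.$$ Its exact solution $\mathbf{U}^{exa}=(h^{exa},\mathbf{q}^{exa})^T$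 means: $h^{exa}$ solves this equation with initial value $h^{exa}(\cdot,0)=h_0^0$ (the leading order term of the initial depth), and, with $H^{exa}=h^{exa}+b$, $$\mathbf{q}^{exa}=-\sqrt{\frac{(h^{exa})^{\eta+1}}{k^2}}\frac{\nabla H^{exa}}{\sqrt{|\nabla H^{exa}|}}.$$ Formal setting: space is kept continuous, and all functions (including the exact solution) are assumed as smooth as needed for the expressions and for the usual Runge-Kutta order statements to make sense. The numerical solution and the stage values, which depend on $\varepsilon$, are assumed to admit Chapman-Enskog expansions $$h=h_0+\mathcal{O}(\varepsilon),\qquad \mathbf{q}=\mathbf{q}_0+\mathcal{O}(\varepsilon)\qquad(\varepsilon\to0)$$ with $h_0>0$, compatible with the spatial differential operators and nonlinear expressions appearing in the scheme (i.e. each such expression converges, as $\varepsilon\to0$, to the same expression evaluated at the leading order terms). Well-prepared initial conditions: $h^0=h_0^0+\mathcal{O}(\varepsilon)$, $\mathbf{q}^0=\mathbf{q}_0^0+\mathcal{O}(\varepsilon)$ and $$\mathbf{q}_0^0=-\sqrt{\frac{(h_0^0)^{\eta+1}}{k^2}}\frac{\nabla H_0^0}{\sqrt{|\nabla H_0^0|}},\qquad H_0^0=h_0^0+b.$$ Asymptotically accurate (AA): the scheme maintains its order of temporal accuracy for the limiting equation as $\varepsilon\to0$, which here is expressed by the displayed one-step error estimate.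
   Formalization: Added since the claim fails otherwise: a_ii ≠ 0 for i ≥ 2; and the estimate is stated at points x where ∇H_0^0 ≠ 0, or near which the stage and exact surfaces are flat. Smoothness is read as C^∞, with stage depths and their derivatives tending to the initial ones as Δt→0. *)

(* Defs.v *)
From HB Require Import structures.
From mathcomp Require Import all_boot all_order all_algebra.
From mathcomp Require Import all_classical all_reals all_analysis.

Set Implicit Arguments.
Unset Strict Implicit.
Unset Printing Implicit Defensive.

Import Order.TTheory GRing.Theory Num.Theory numFieldNormedType.Exports.

Local Open Scope classical_set_scope.
Local Open Scope ring_scope.

Definition iter_deriv (R : realType) (V W : normedModType R) (vs : seq V)
  (f : V -> W) : V -> W := foldr (fun v g x => 'D_v g x) f vs.

(* For D open and V finite-dimensional this is C^oo on D: derivatives in all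
   directions, of all orders, exist and are differentiable. *)
Definition smooth_on (R : realType) (V W : normedModType R) (D : set V)
    (f : V -> W) : Prop :=
  forall (vs : seq V) (x : V), D x -> differentiable (iter_deriv vs f) x.

Definition smooth_cvg_on (R : realType) (V W : normedModType R) (D : set V)
    (u : R -> V -> W) (u0 : V -> W) : Prop :=
  forall (vs : seq V) (x : V), D x ->
    iter_deriv vs (u t) x @[t --> 0^'+] --> iter_deriv vs u0 x.

Definition bigO_pow (R : realType) (W : normedModType R) (n : nat)
    (u : R -> W) : Prop :=
  exists C : R, \forall t \near 0^'+, `|u t| <= C * t ^+ n.

(* Explicit coefficients ex_*, implicit coefficients im_*.  No abscissae: they are
   the row sums of ex_mx and im_mx, and do not occur for autonomous right-hand
   sides. *)
Record imex_tableau (R : realType) (s : nat) := ImexTableau {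
  ex_mx : 'M[R]_s;
  ex_wt : 'rV[R]_s;
  im_mx : 'M[R]_s;
  im_wt : 'rV[R]_s }.

Definition explicit_part (R : realType) s (M : imex_tableau R s) : Prop :=
  forall i j : 'I_s, (i <= j)%N -> ex_mx M i j = 0.

(* Every stage is implicit, except possibly the first one: a_11 = 0 is allowed
   (methods of type CK and ARS, for which U^(1) = U^n), but a_ii != 0 for i > 1.
   Without the latter im_mx could be strictly lower triangular, i.e. the whole
   method explicit. *)
Definition diagonally_implicit (R : realType) s (M : imex_tableau R s) : Prop :=
  (forall i j : 'I_s, (i < j)%N -> im_mx M i j = 0) /\
  (forall i : 'I_s, (0 < i)%N -> im_mx M i i != 0).

Definition globally_stiffly_accurate (R : realType) s
    (M : imex_tableau R s.+1) : Prop :=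
  ex_wt M = row ord_max (ex_mx M) /\ im_wt M = row ord_max (im_mx M).

(* One step of size dt, from y0 to y1, with stages Y; FY j and GY j are the
   values of the two right-hand sides at the stage Y j. *)
Definition imex_step (R : realType) s (M : imex_tableau R s) (E : lmodType R)
    (dt : R) (y0 : E) (Y FY GY : 'I_s -> E) (y1 : E) : Prop :=
  (forall i : 'I_s,
     Y i = y0 + dt *: (\sum_(j < s | (j < i)%N) ex_mx M i j *: FY j)
              + dt *: (\sum_(j < s | (j <= i)%N) im_mx M i j *: GY j)) /\
  y1 = y0 + dt *: (\sum_(i < s) ex_wt M 0 i *: FY i)
          + dt *: (\sum_(i < s) im_wt M 0 i *: GY i).

(* Classical order p: the local error is O(dt^(p+1)) for every smooth system
   y' = f(y) + g(y).  The implicit stage equations may have spurious solutions;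
   as usual the stages are those that tend to y 0 with dt. *)
Definition imex_order (R : realType) s (M : imex_tableau R s) (p : nat) : Prop :=
  forall (N : nat) (D : set 'rV[R]_N) (f g : 'rV[R]_N -> 'rV[R]_N)
    (T : R) (y : R -> 'rV[R]_N)
    (Y : R -> 'I_s -> 'rV[R]_N) (y1 : R -> 'rV[R]_N),
    open D -> smooth_on D f -> smooth_on D g ->
    0 < T -> D (y 0) -> y t @[t --> 0^'+] --> y 0 ->
    (forall t, 0 < t < T -> D (y t) /\ is_derive t 1 y (f (y t) + g (y t))) ->
    (forall i, Y dt i @[dt --> 0^'+] --> y 0) ->
    (\forall dt \near 0^'+,
       imex_step M dt (y 0) (Y dt) (f \o Y dt) (g \o Y dt) (y1 dt)) ->
    bigO_pow p.+1 (fun dt => y1 dt - y dt).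

Definition enorm (R : realType) d (v : 'rV[R]_d) : R :=
  Num.sqrt (\sum_(i < d) v 0 i ^+ 2).

Definition grad (R : realType) d (f : 'rV[R]_d -> R) (x : 'rV[R]_d) : 'rV[R]_d :=
  \row_(i < d) 'D_(delta_mx 0 i) f x.

Definition div (R : realType) d (v : 'rV[R]_d -> 'rV[R]_d) (x : 'rV[R]_d) : R :=
  \sum_(i < d) 'D_(delta_mx 0 i) (fun y => v y 0 i) x.

Record swe_data (R : realType) (d : nat) := SweData {
  grav : R;
  mann : R;
  eta : R;
  dx : R;
  bot : 'rV[R]_d -> R }.

Definition state (R : realType) (d : nat) : Type := 'rV[R]_d -> R * 'rV[R]_d.

Definition depth (R : realType) d (U : state R d) : 'rV[R]_d -> R :=
  fun x => (U x).1.

Definition momentum (R : realType) d (U : state R d) : 'rV[R]_d -> 'rV[R]_d :=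
  fun x => (U x).2.

Definition surface (R : realType) d (P : swe_data R d) (h : 'rV[R]_d -> R) :
  'rV[R]_d -> R := fun x => h x + bot P x.

(* sqrt(h^(eta+1)/k^2) (grad H) / sqrt|grad H|, with H = h + b; since 0^-1 = 0 it
   is 0 where grad H = 0. *)
Definition flux (R : realType) d (P : swe_data R d) (h : 'rV[R]_d -> R)
    (x : 'rV[R]_d) : 'rV[R]_d :=
  Num.sqrt (h x `^ (eta P + 1) / mann P ^+ 2) *:
    ((Num.sqrt (enorm (grad (surface P h) x)))^-1 *: grad (surface P h) x).

Definition mu (R : realType) d (P : swe_data R d) (e : R) : R :=
  expR (- (e ^+ 2) / dx P).

(* div (q (x) q / h), row by row. *)
Definition convection (R : realType) d (U : state R d) (x : 'rV[R]_d) :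
    'rV[R]_d :=
  \row_(i < d)
    div (fun y => (momentum U y 0 i / depth U y) *: momentum U y) x.

Definition pressure (R : realType) d (P : swe_data R d) (U : state R d)
    (x : 'rV[R]_d) : 'rV[R]_d :=
  grad (fun y => grav P / 2 * depth U y ^+ 2) x.

Definition bottom_source (R : realType) d (P : swe_data R d) (U : state R d)
    (x : 'rV[R]_d) : 'rV[R]_d :=
  (grav P * depth U x) *: grad (bot P) x.

(* gamma q, with gamma = g k^2 |q| / h^eta. *)
Definition friction (R : realType) d (P : swe_data R d) (U : state R d)
    (x : 'rV[R]_d) : 'rV[R]_d :=
  (grav P * mann P ^+ 2 * enorm (momentum U x) / depth U x `^ eta P)
    *: momentum U x.

Definition swe_F (R : realType) d (P : swe_data R d) (e : R) (U : state R d) :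
    state R d := fun x =>
  (- div (momentum U) x - mu P e * div (flux P (depth U)) x,
   - convection U x).

Definition swe_G (R : realType) d (P : swe_data R d) (e : R) (U : state R d) :
    state R d := fun x =>
  (mu P e * div (flux P (depth U)) x,
   - ((e ^+ 2)^-1 *: pressure P U x)
   - (e ^+ 2)^-1 *: bottom_source P U x
   - (e ^+ 2)^-1 *: friction P U x).

(* 'D_v is total; under these conditions all the derivatives taken in swe_F and
   swe_G are genuine. *)
Definition regular_state (R : realType) d (P : swe_data R d)
    (D : set 'rV[R]_d) (U : state R d) : Prop :=
  forall x, D x ->
    [/\ 0 < depth U x, differentiable (depth U) x,
        differentiable (momentum U) x & differentiable (flux P (depth U)) x].

(* Besides U e = U0 + O(e), each expression occurring in swe_F or swe_G has to
   converge to its value at U0: this is the compatibility of the expansion with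
   the scheme. *)
Definition chapman_enskog (R : realType) d (P : swe_data R d)
    (D : set 'rV[R]_d) (U : R -> state R d) (U0 : state R d) : Prop :=
  [/\ \forall e \near 0^'+, regular_state P D (U e),
      regular_state P D U0 &
      forall x, D x ->
        bigO_pow 1 (fun e => U e x - U0 x) /\
        [/\ div (momentum (U e)) x @[e --> 0^'+] --> div (momentum U0) x,
            div (flux P (depth (U e))) x @[e --> 0^'+]
              --> div (flux P (depth U0)) x,
            convection (U e) x @[e --> 0^'+] --> convection U0 x &
            [/\ pressure P (U e) x @[e --> 0^'+] --> pressure P U0 x,
                bottom_source P (U e) x @[e --> 0^'+] --> bottom_source P U0 x &
                friction P (U e) x @[e --> 0^'+] --> friction P U0 x]]].

Definition well_prepared (R : realType) d (P : swe_data R d)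
    (D : set 'rV[R]_d) (Un : R -> state R d) (Un0 : state R d) : Prop :=
  forall x, D x ->
    bigO_pow 1 (fun e => Un e x - Un0 x) /\
    momentum Un0 x = - flux P (depth Un0) x.

Definition limit_solution (R : realType) d (P : swe_data R d)
    (D : set 'rV[R]_d) (T : R) (h0 : 'rV[R]_d -> R) (Uexa : R -> state R d) :
    Prop :=
  [/\ smooth_on [set z : R * 'rV[R]_d | 0 < z.1 < T /\ D z.2]
        (fun z => depth (Uexa z.1) z.2),
      forall t, 0 < t < T -> regular_state P D (Uexa t),
      forall t x, 0 < t < T -> D x ->
        is_derive t 1 (fun r => depth (Uexa r) x)
          (div (flux P (depth (Uexa t))) x),
      (forall x, D x -> depth (Uexa 0) x = h0 x) /\
        smooth_cvg_on D (fun t => depth (Uexa t)) h0 &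
      forall t x, 0 <= t < T -> D x ->
        momentum (Uexa t) x = - flux P (depth (Uexa t)) x].

(* The limiting flux is a smooth function of (x, h, grad h) only where
   grad H != 0, and Runge-Kutta order fails where the data meet its
   singularity: with d = 1, k = 1, eta = -1, b = 0, on x > 0, the implicit Euler
   equation h = 1 + dt (|h'|^(1/2) sgn h')' has, besides h = 1, the smooth
   solution h = 1 + 12 dt^2 / x^3.  So either grad H00 != 0 at x, or the water
   stays at rest around x. *)
Definition smooth_flux_at (R : realType) d (P : swe_data R d) s
    (h00 : 'rV[R]_d -> R) (hS0 : R -> 'I_s -> 'rV[R]_d -> R)
    (hexa : R -> 'rV[R]_d -> R) (x : 'rV[R]_d) : Prop :=
  grad (surface P h00) x != 0 \/
  \forall t \near 0^'+, \forall y \near x,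
    (forall i, grad (surface P (hS0 t i)) y = 0) /\
    grad (surface P (hexa t)) y = 0.

(* Main.v *)
Require Import Defs.
From mathcomp Require Import all_boot all_order all_algebra.
From mathcomp Require Import all_classical all_reals all_analysis.
From mathcomp Require Import ring lra zify.
Import Order.TTheory GRing.Theory Num.Theory numFieldNormedType.Exports.
Local Open Scope classical_set_scope.
Local Open Scope ring_scope.
Set Implicit Arguments.
Unset Strict Implicit.
Unset Printing Implicit Defensive.

(** As [e -> 0], [e ^ 2] times the momentum stages says that the implicit
    coefficients annihilate (pressure + bottom + friction); since the diagonal
    of [im_mx] does not vanish (or else the first stage is the well-prepared
    initial value), every stage satisfies [q = - flux h], and then the explicit
    mass flux vanishes. So the limiting depths are the stages of the implicit
    method applied to [h_t = div (flux h)], and, by global stiff accuracy, the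
    limiting update is the last stage.

    The order, which is a statement on ODEs, is transferred to this PDE through
    the jets of the depth at a fixed point. Where [grad H != 0] the derivative
    of the jet variable [w] is an algebraic expression in the jet variables of
    length at most [size w + 2]. This infinite system is replaced by finitely
    many Picard iterates, regarded as one ODE in which level [0] is constant and
    the derivative of level [k.+1] is the right-hand side at level [k]. Being
    triangular, this ODE is solved by quadratures and has explicit Runge-Kutta
    stages, so that [imex_order] applies to it without any existence theorem;
    and level [k] differs by [O(dt ^ k.+1)] from the jets of the true solution,
    as well as from those of the true stages. *)

(** * Algebraic expressions *)

(** Right-hand sides are kept as syntax, so that continuity, differentiability, Lipschitz bounds and
    the variables that occur are all obtained by induction on the term. The class is closed under
    differentiation, as the jets of the flux require. *)
Inductive expr (R V : Type) : Type :=
  | Cst of R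
  | Var of V
  | Add of expr R V & expr R V
  | Mul of expr R V & expr R V
  | Pow of R & expr R V.
Arguments Cst {R V}.
Arguments Var {R V}.

Fixpoint eeval (R : realType) V (E : expr R V) (r : V -> R) : R :=
  match E with
  | Cst c => c
  | Var v => r v
  | Add E1 E2 => eeval E1 r + eeval E2 r
  | Mul E1 E2 => eeval E1 r * eeval E2 r
  | Pow c E1 => eeval E1 r `^ c
  end.

(** A set on which evaluation is smooth; being cut out by strict inequalities, it persists under
    small perturbations of the environment. *)
Fixpoint edom (R : realType) V (E : expr R V) (r : V -> R) : Prop :=
  match E with
  | Cst _ | Var _ => True
  | Add E1 E2 | Mul E1 E2 => edom E1 r /\ edom E2 r
  | Pow c E1 => edom E1 r /\ 0 < eeval E1 r
  end.

(** The derivation that extends [del]: a directional derivative when every [del v] is a constant,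
    the total derivative of jet calculus when [del] is [jet_shift]. *)
Fixpoint ediff (R : realType) V (del : V -> expr R V) (E : expr R V) :
    expr R V :=
  match E with
  | Cst _ => Cst 0
  | Var v => del v
  | Add E1 E2 => Add (ediff del E1) (ediff del E2)
  | Mul E1 E2 => Add (Mul (ediff del E1) E2) (Mul E1 (ediff del E2))
  | Pow c E1 => Mul (Mul (Cst c) (Pow (c - 1) E1)) (ediff del E1)
  end.

Fixpoint esubst (R : realType) V V' (sg : V -> expr R V') (E : expr R V) :
    expr R V' :=
  match E with
  | Cst c => Cst c
  | Var v => sg v
  | Add E1 E2 => Add (esubst sg E1) (esubst sg E2)
  | Mul E1 E2 => Mul (esubst sg E1) (esubst sg E2)
  | Pow c E1 => Pow c (esubst sg E1)
  end.

Fixpoint evars (R : realType) V (Q : V -> Prop) (E : expr R V) : Prop :=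
  match E with
  | Cst _ => True
  | Var v => Q v
  | Add E1 E2 | Mul E1 E2 => evars Q E1 /\ evars Q E2
  | Pow c E1 => evars Q E1
  end.

Lemma edom_ediff (R : realType) V (del : V -> expr R V) E r :
  (forall v, edom (del v) r) -> edom E r -> edom (ediff del E) r.
Proof.
by move=> dd; elim: E => //= [E1 IH1 E2 IH2 [? ?]|E1 IH1 E2 IH2 [? ?]|c E1 IH1 [? ?]];
  intuition.
Qed.

(** [Q'] has to contain [Q], since the product and power rules keep undifferentiated factors. *)
Lemma evars_ediff (R : realType) V (Q Q' : V -> Prop) (del : V -> expr R V) E :
  (forall v, Q v -> Q' v) -> (forall v, Q v -> evars Q' (del v)) ->
  evars Q E -> evars Q' (ediff del E).
Proof.
move=> QQ Qd.
have sub E' : evars Q E' -> evars Q' E'.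
  by elim: E' => //= [E1 ? E2 ? []|E1 ? E2 ? []]; intuition.
elim: E => //= [E1 IH1 E2 IH2 []|E1 IH1 E2 IH2 []|c E1 IH1]; intuition.
Qed.

Lemma eval_esubst (R : realType) V V' (sg : V -> expr R V') E r :
  eeval (esubst sg E) r = eeval E (fun v => eeval (sg v) r).
Proof. by elim: E => //= [E1 -> E2 ->|E1 -> E2 ->|c E ->]. Qed.

Lemma edom_esubst (R : realType) V V' (sg : V -> expr R V') E r :
  (forall v, edom (sg v) r) ->
  edom E (fun v => eeval (sg v) r) -> edom (esubst sg E) r.
Proof.
move=> ds; elim: E => //= [E1 ? E2 ? []|E1 ? E2 ? []|c E ?]; rewrite ?eval_esubst; intuition.
Qed.

Lemma differentiable_powR (R : realType) (a x : R) :
  0 < x -> differentiable (fun y : R => y `^ a) x.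
Proof.
move=> x0; apply/derivable1_diffP; apply: derivable_powR.
by rewrite in_itv/= x0.
Qed.

Lemma eval_differentiable (R : realType) (W : normedModType R) V (E : expr R V)
    (r : W -> V -> R) (y : W) :
  (forall v, differentiable (fun z => r z v) y) -> edom E (r y) ->
  differentiable (fun z => eeval E (r z)) y.
Proof.
move=> dr; elim: E => //= [E1 IH1 E2 IH2 [/IH1 d1 /IH2 d2]
  |E1 IH1 E2 IH2 [/IH1 d1 /IH2 d2]
  |c E IH [/IH d1 p1]].
- exact: differentiableD.
- exact: differentiableM.
- by apply: (@differentiable_comp _ _ _ _ _ (fun z : R => z `^ c)) => //;
  exact: differentiable_powR.
Qed.

(** Soundness of [ediff]: the chain rule by induction on the term, where [edom] makes each power
    differentiable at its base. *)
Lemma eval_derive (R : realType) (W : normedModType R) V (del : V -> expr R V)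
    (E : expr R V) (r : W -> V -> R) (y u : W) :
  (forall v, differentiable (fun z => r z v) y) ->
  (forall v, 'D_u (fun z => r z v) y = eeval (del v) (r y)) ->
  edom E (r y) ->
  'D_u (fun z => eeval E (r z)) y = eeval (ediff del E) (r y).
Proof.
move=> dr Dr; elim: E => //= [c _
  |E1 IH1 E2 IH2 [e1 e2]
  |E1 IH1 E2 IH2 [e1 e2]
  |c E IH [e1 p1]].
- exact: derive_cst.
- rewrite deriveD ?IH1 ?IH2//; apply: diff_derivable; exact: eval_differentiable.
- rewrite deriveM ?IH1 ?IH2//; [|apply: diff_derivable; exact: eval_differentiable..].
  by rewrite /GRing.scale/= addrC mulrC.
- have d1 := eval_differentiable dr e1.
  have d2 := differentiable_powR c p1.
  have -> : (fun z => eeval E (r z) `^ c) = (fun x : R => x `^ c) \o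
    (fun z => eeval E (r z)) by [].
  rewrite deriveE; last exact: differentiable_comp.
  rewrite diff_comp// deriv1E; last exact/derivable1_diffP.
  have <- := IH e1.
  rewrite [in RHS]deriveE//= /GRing.scale/= mulrC derive1E.
  by have /@derive_val -> := is_derive1_powR c p1.
Qed.

Lemma cvg_powR_base (R : realType) (a x : R) : 0 < x ->
  y `^ a @[y --> x] --> x `^ a.
Proof. by move=> x0; exact: (differentiable_continuous (differentiable_powR a x0)). Qed.

Lemma eval_cvg (R : realType) T (F : set_system T) {FF : Filter F} V
    (E : expr R V) (r : T -> V -> R) (r0 : V -> R) :
  (forall v, r t v @[t --> F] --> r0 v) -> edom E r0 ->
  eeval E (r t) @[t --> F] --> eeval E r0.
Proof.
move=> cr; elim: E => //= [c _
  |E1 IH1 E2 IH2 [/IH1 d1 /IH2 d2]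
  |E1 IH1 E2 IH2 [/IH1 d1 /IH2 d2]
  |c E IH [/IH d1 p1]].
- exact: cvg_cst.
- exact: cvgD.
- exact: cvgM.
- exact: (cvg_comp (fun t => eeval E (r t)) (fun y : R => y `^ c) d1 (cvg_powR_base p1)).
Qed.

Lemma near_edom (R : realType) T (F : set_system T) {FF : Filter F} V
    (E : expr R V) (r : T -> V -> R) (r0 : V -> R) :
  (forall v, r t v @[t --> F] --> r0 v) -> edom E r0 ->
  \forall t \near F, edom E (r t).
Proof.
move=> cr; elim: E => /= [c _|v _
  |E1 IH1 E2 IH2 [/IH1 d1 /IH2 d2]
  |E1 IH1 E2 IH2 [/IH1 d1 /IH2 d2]
  |c E IH [e1 p1]];
  do ?[exact: nearW | exact: filterI].
apply: filterI; first exact: IH.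
exact: (cvgr_gt _ (eval_cvg cr e1) _ p1).
Qed.

(** * One-sided asymptotics *)

(** The constant in [bigO_pow] carries no sign; a positive one is wanted whenever bounds are
    multiplied. *)
Lemma bigO_pow_gt0 (R : realType) (W : normedModType R) n (u : R -> W) :
  bigO_pow n u ->
  exists2 C : R, 0 < C & \forall t \near 0^'+, `|u t| <= C * t ^+ n.
Proof.
case=> C uC; exists (`|C| + 1); first by rewrite ltr_wpDl.
near=> t; have t0 : 0 < t by near: t; exact: nbhs_right_gt.
apply: (le_trans (near uC t _)) => //.
by rewrite ler_wpM2r ?exprn_ge0 ?ltW// (le_lt_trans (ler_norm _))// ltrDl.
Unshelve. all: by end_near. Qed.

Lemma eq_near_bigO (R : realType) (W : normedModType R) n (u v : R -> W) :
  (\forall t \near 0^'+, u t = v t) -> bigO_pow n u -> bigO_pow n v.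
Proof.
move=> uv [C uC]; exists C; near=> t.
rewrite -(near uv t)//; exact: (near uC t).
Unshelve. all: by end_near. Qed.

Lemma near0_bigO (R : realType) (W : normedModType R) n (u : R -> W) :
  (\forall t \near 0^'+, u t = 0) -> bigO_pow n u.
Proof. by move=> u0; exists 0; apply: filterS u0 => t ->; rewrite normr0 mul0r. Qed.

Lemma bigOD (R : realType) (W : normedModType R) n (u v : R -> W) :
  bigO_pow n u -> bigO_pow n v -> bigO_pow n (fun t => u t + v t).
Proof.
move=> [C uC] [C' vC]; exists (C + C'); near=> t.
rewrite mulrDl (le_trans (ler_normD _ _))// lerD//; [exact: (near uC t)|exact: (near vC t)].
Unshelve. all: by end_near. Qed.

Lemma bigON (R : realType) (W : normedModType R) n (u : R -> W) :
  bigO_pow n u -> bigO_pow n (fun t => - u t).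
Proof. by move=> [C uC]; exists C; near do rewrite normrN. Unshelve. all: by end_near. Qed.

Lemma bigOB_trans (R : realType) (W : normedModType R) n (u v w : R -> W) :
  bigO_pow n (fun t => u t - v t) -> bigO_pow n (fun t => v t - w t) ->
  bigO_pow n (fun t => u t - w t).
Proof.
move=> uv vw; apply: eq_near_bigO (bigOD uv vw).
by apply: nearW => t; rewrite addrA subrK.
Qed.

Lemma bigOBC (R : realType) (W : normedModType R) n (u v : R -> W) :
  bigO_pow n (fun t => u t - v t) -> bigO_pow n (fun t => v t - u t).
Proof.
by move=> /bigON; apply: eq_near_bigO; apply: nearW => t; rewrite opprB.
Qed.

Lemma bigO_sum (R : realType) (W : normedModType R) n (I : Type) (r : seq I)
    (P : pred I) (u : I -> R -> W) :
  (forall i, P i -> bigO_pow n (u i)) ->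
  bigO_pow n (fun t => \sum_(i <- r | P i) u i t).
Proof.
move=> Ou; elim: r => [|i r IH].
  by apply: near0_bigO; apply: nearW => t; rewrite big_nil.
case Pi: (P i).
  apply: eq_near_bigO (bigOD (Ou i Pi) IH).
  by apply: nearW => t; rewrite big_cons Pi.
by apply: eq_near_bigO IH; apply: nearW => t; rewrite big_cons Pi.
Qed.

Lemma bigO_bounded (R : realType) (W : normedModType R) (u : R -> W) (l : W) :
  u t @[t --> 0^'+] --> l -> bigO_pow 0 u.
Proof.
move=> ul; exists (`|l| + 1).
have := cvgr_norm_le l ul (`|l| + 1); rewrite ltrDl => /(_ _ ltr01).
by apply: filterS => t; rewrite expr0 mulr1.
Qed.

Lemma bigOM (R : realType) m n (u v : R -> R) :
  bigO_pow m u -> bigO_pow n v -> bigO_pow (m + n) (fun t => u t * v t).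
Proof.
move=> /bigO_pow_gt0[C C0 uC] /bigO_pow_gt0[C' C'0 vC]; exists (C * C'); near=> t.
rewrite normrM exprD mulrACA ler_pM//; [exact: (near uC t)|exact: (near vC t)].
Unshelve. all: by end_near. Qed.

Lemma bigOZ (R : realType) n (c : R) (u : R -> R) :
  bigO_pow n u -> bigO_pow n (fun t => c * u t).
Proof.
apply: (@bigOM _ 0 n (fun=> c)).
by apply: (@bigO_bounded _ _ _ c); exact: cvg_cst.
Qed.

Lemma bigO_id (R : realType) : bigO_pow 1 (@id R).
Proof.
exists 1; near=> t; rewrite mul1r expr1 ger0_norm// ltW//.
Unshelve. all: by end_near. Qed.

Lemma bigO_cvg0 (R : realType) (W : normedModType R) n (u : R -> W) :
  bigO_pow n.+1 u -> u t @[t --> 0^'+] --> (0 : W).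
Proof.
move=> /bigO_pow_gt0[C C0 uC]; apply/norm_cvg0P.
apply: (@squeeze_cvgr _ _ _ _ (fun=> 0) (fun t => C * t ^+ n.+1)).
- by near=> t; rewrite normr_ge0 (near uC t).
- exact: cvg_cst.
- rewrite -[X in _ --> X](mulr0 C); apply: cvgM; first exact: cvg_cst.
  apply: cvg_at_right_filter.
  have e : (0 : R) ^+ n.+1 = 0 by rewrite expr0n.
  by rewrite -[X in _ --> X]e; exact: (@exprn_continuous _ n.+1 (0 : R)).
Unshelve. all: by end_near. Qed.

(** The derivative of the power is continuous at [l], hence bounded by [K] on a ball around it; the
    ball is convex, so the mean value theorem applies between any two of its points. *)
Lemma powR_lipschitz_near (R : realType) (c l : R) : 0 < l ->
  exists K e : R, [/\ 0 < K, 0 < e & forall x y : R, `|l - x| < e -> `|l - y| < e ->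
    `|x `^ c - y `^ c| <= K * `|x - y|].
Proof.
move=> l0; pose K := `|c * l `^ (c - 1)| + 1.
have Kc : (fun y : R => `|c * y `^ (c - 1)|) y @[y --> l] --> `|c * l `^ (c - 1)|.
  apply: cvg_norm; apply: cvgM; first exact: cvg_cst.
  exact: cvg_powR_base.
have nK := cvgr_le _ Kc K.
rewrite ltrDl in nK; have {nK} := filterI (nK _ ltr01) (lt_nbhsr l0).
case=> e /= e0 eK; exists K, e; split => //; first by rewrite ltr_wpDl.
have main x y : x <= y -> `|l - x| < e -> `|l - y| < e ->
    `|x `^ c - y `^ c| <= K * `|x - y|.
  move=> xy lx ly.
  have ball z : z \in `[x, y]%R -> `|l - z| < e.
    rewrite in_itv/= => /andP[xz zy]; move: lx ly; rewrite !ltr_distl.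
    by move=> /andP[l1 l2] /andP[l3 l4]; apply/andP; split; lra.
  have [||z zxy] := @MVT_segment R (fun y => y `^ c) (fun y => c * y `^ (c - 1)) x y xy.
  - move=> z zxy; apply: is_derive1_powR.
    by have [] := eK z (ball z (subset_itv_oo_cc zxy)).
  - apply: derivable_within_continuous => z zxy; apply/derivable1_diffP.
    by apply: differentiable_powR; have [] := eK z (ball z zxy).
  - move=> E; rewrite distrC E normrM distrC ler_wpM2r//.
    by have [] := eK z (ball z zxy).
move=> x y; have [xy|/ltW yx] := leP x y; first exact: main.
by move=> lx ly; rewrite distrC [`|x - y|]distrC main.
Qed.

(** Evaluation is locally Lipschitz on [edom]: both environments tend to [r0], so factors stay
    bounded and powers are Lipschitz. Closeness of order [n] is asked only of variables satisfying
    [Q], which allows the loss of derivatives to be counted. *)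
Lemma eval_bigO (R : realType) V (E : expr R V) (Q : V -> Prop) n
    (r r' : R -> V -> R) (r0 : V -> R) :
  (forall v, r t v @[t --> 0^'+] --> r0 v) ->
  (forall v, r' t v @[t --> 0^'+] --> r0 v) ->
  (forall v, Q v -> bigO_pow n (fun t => r t v - r' t v)) ->
  edom E r0 -> evars Q E -> bigO_pow n (fun t => eeval E (r t) - eeval E (r' t)).
Proof.
move=> cr cr' Qr; elim: E => /= [c _ _|v _ /Qr//
  |E1 IH1 E2 IH2 [e1 e2] [q1 q2]
  |E1 IH1 E2 IH2 [e1 e2] [q1 q2]
  |c E IH [e1 p1] q1].
- by apply: near0_bigO; apply: nearW => t; rewrite subrr.
- apply: eq_near_bigO (bigOD (IH1 e1 q1) (IH2 e2 q2)).
  by apply: nearW => t; rewrite opprD addrACA.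
- have b1 : bigO_pow 0 (fun t => eeval E1 (r' t)).
    exact: bigO_bounded (eval_cvg cr' e1).
  have b2 : bigO_pow 0 (fun t => eeval E2 (r t)).
    exact: bigO_bounded (eval_cvg cr e2).
  have := bigOD (bigOM b2 (IH1 e1 q1)) (bigOM b1 (IH2 e2 q2)).
  apply: eq_near_bigO; apply: nearW => t.
  rewrite !mulrBr addrA [eeval E2 (r t) * _]mulrC.
  by rewrite [eeval E2 (r t) * _]mulrC subrK.
- have [K [e [K0 e0 He]]] := powR_lipschitz_near c p1.
  have /bigO_pow_gt0[C C0 HC] := IH e1 q1.
  have n1 := cvgr_dist_lt _ _ (eval_cvg cr e1) _ e0.
  have n2 := cvgr_dist_lt _ _ (eval_cvg cr' e1) _ e0.
  exists (K * C); near=> t.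
  apply: (@le_trans _ _ (K * `|eeval E (r t) - eeval E (r' t)|)).
    apply: He; [by near: t; exact: n1|by near: t; exact: n2].
  by rewrite -mulrA ler_pM2l//; exact: (near HC t).
Unshelve. all: by end_near. Qed.

(** Integration gains one order. The mean value theorem is applied on [[a, t]] and [a] then tends to
    0, because only the right limit of [u] at 0 is available. *)
Lemma bigO_derive (R : realType) (n : nat) (u du : R -> R) :
  u t @[t --> 0^'+] --> (0 : R) ->
  (\forall t \near (0 : R)^'+, is_derive t (1 : R) u (du t)) ->
  bigO_pow n du -> bigO_pow n.+1 u.
Proof.
move=> u0 Du /bigO_pow_gt0[C C0 HC]; exists C.
have := filterI Du HC => -[e /= e0 He]; near=> t.
have t0 : 0 < t by near: t; exact: nbhs_right_gt.
have te : t < e by near: t; exact: nbhs_right_lt.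
have He' x : 0 < x -> x < e -> is_derive x (1 : R) u (du x) /\ `|du x| <= C * x ^+ n.
  by move=> x0 xe; apply: He => //=; rewrite sub0r normrN gtr0_norm.
have key a : 0 < a -> a < t -> `|u t - u a| <= C * t ^+ n.+1.
  move=> a0 at_.
  have [||z zat E] := @MVT_segment R u du a t (ltW at_).
  - by move=> z /[!in_itv]/= /andP[az zt];
    have [] := He' z (lt_trans a0 az) (lt_trans zt te).
  - apply: derivable_within_continuous => z /[!in_itv]/= /andP[az zt].
    by have [[]] := He' z (lt_le_trans a0 az) (le_lt_trans zt te).
  move: zat => /[!in_itv]/= /andP[az zt].
  have z0 := lt_le_trans a0 az.
  have [_ dz] := He' z z0 (le_lt_trans zt te).
  rewrite E normrM exprSr mulrA ler_pM//.
  - by rewrite (le_trans dz)// ler_pM2l// lerXn2r ?nnegrE// ltW.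
  - by rewrite gtr0_norm ?subr_gt0// gerBl ltW.
have lim : `|u t - u a| @[a --> 0^'+] --> `|u t - 0|.
  by apply: cvg_norm; apply: cvgB => //; exact: cvg_cst.
rewrite -[u t]subr0 -(cvg_lim (@Rhausdorff R) lim); apply: limr_le.
  by apply/cvg_ex; eexists; exact: lim.
near=> a; apply: key; near: a; [exact: nbhs_right_gt|exact: nbhs_right_lt].
Unshelve. all: by end_near. Qed.

(** * Calculus *)

(** The two difference quotients are the same function of [h], so the equality holds for the total
    operator ['D] whether or not the limit exists. *)
Lemma derive_affine (R : realType) (V W X : normedModType R) (f : W -> X)
    (A : V -> W) (x v : V) (w : W) :
  (forall h : R, A (h *: v + x) = h *: w + A x) ->
  'D_v (f \o A) x = 'D_w f (A x).
Proof.
move=> Ax; rewrite /derive.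
suff -> : (fun h : R => h^-1 *: ((f \o A \o shift x) (h *: v) - (f \o A) x)) =
   (fun h : R => h^-1 *: ((f \o shift (A x)) (h *: w) - f (A x))) by [].
by apply/funext => h /=; rewrite Ax.
Qed.

Lemma derivable_affine (R : realType) (V W X : normedModType R) (f : W -> X)
    (A : V -> W) (x v : V) (w : W) :
  (forall h : R, A (h *: v + x) = h *: w + A x) ->
  derivable f (A x) w -> derivable (f \o A) x v.
Proof.
move=> Ax; rewrite /derivable.
suff -> : (fun h : R => h^-1 *: ((f \o A \o shift x) (h *: v) - (f \o A) x)) =
   (fun h : R => h^-1 *: ((f \o shift (A x)) (h *: w) - f (A x))) by [].
by apply/funext => h /=; rewrite Ax.
Qed.

Lemma is_derive_line (R : realType) (V X : normedModType R) (f : V -> X)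
    (y u : V) (a : R) : differentiable f (y + a *: u) ->
  is_derive a (1 : R) (fun t => f (y + t *: u)) ('D_u f (y + a *: u)).
Proof.
move=> df; pose A (t : R) : V := y + t *: u.
have AE (h : R) : A (h *: (1 : R) + a) = h *: u + A a.
  by rewrite /A scalerDl /GRing.scale/= mulr1 addrCA.
apply: DeriveDef; last exact: (derive_affine f AE).
by apply: (derivable_affine AE); exact: diff_derivable.
Qed.

(** The mean value theorem twice: along [u] for the increment of [f] under [s *: v], then along [v]
    for ['D_u f]. *)
Lemma second_difference (R : realType) (V : normedModType R) (f : V -> R)
    (x u v : V) (s : R) : 0 < s ->
  (forall a b, 0 <= a <= s -> 0 <= b <= s ->
    differentiable f (x + a *: u + b *: v) /\
    differentiable ('D_u f) (x + a *: u + b *: v)) ->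
  exists a b, [/\ 0 <= a <= s, 0 <= b <= s &
    f (x + s *: u + s *: v) - f (x + s *: u) - f (x + s *: v) + f x =
    s ^+ 2 * 'D_v ('D_u f) (x + a *: u + b *: v)].
Proof.
move=> s0 df; have ss : 0 <= s <= s by rewrite ltW/=.
have zs : 0 <= (0 : R) <= s by rewrite lexx ltW.
pose g a := f (x + s *: v + a *: u) - f (x + a *: u).
have Dg a : 0 <= a <= s -> is_derive a (1 : R) g
    ('D_u f (x + s *: v + a *: u) - 'D_u f (x + a *: u)).
  move=> as_; apply: is_deriveB; apply: is_derive_line.
    by rewrite addrAC; have [] := df a s as_ ss.
  by have [] := df a 0 as_ zs; rewrite scale0r addr0.
have [||a] := @MVT_segment R g
  (fun a => 'D_u f (x + s *: v + a *: u) - 'D_u f (x + a *: u)) 0 s (ltW s0).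
- by move=> a /[!in_itv]/= /andP[a0 as_]; apply: Dg; rewrite !ltW.
- by apply: derivable_within_continuous => a /[!in_itv]/= /Dg[].
rewrite in_itv/= => as_ Eg.
have Dk b : 0 <= b <= s -> is_derive b (1 : R)
    (fun b => 'D_u f (x + a *: u + b *: v)) ('D_v ('D_u f) (x + a *: u + b *: v)).
  by move=> bs; apply: is_derive_line; have [] := df a b as_ bs.
have [||b] := @MVT_segment R (fun b => 'D_u f (x + a *: u + b *: v))
  (fun b => 'D_v ('D_u f) (x + a *: u + b *: v)) 0 s (ltW s0).
- by move=> b /[!in_itv]/= /andP[b0 bs]; apply: Dk; rewrite !ltW.
- by apply: derivable_within_continuous => b /[!in_itv]/= /Dk[].
rewrite in_itv/= => bs Ek; exists a, b; split => //.
move: Eg Ek; rewrite /g !scale0r !addr0 !subr0 => Eg Ek.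
rewrite [x + s *: v + a *: u]addrAC Ek in Eg.
rewrite [x + s *: v + s *: u]addrAC in Eg.
by rewrite addrAC -addrA -[f x - _]opprB Eg expr2 [RHS]mulrC mulrA.
Qed.

Lemma derive_comm (R : realType) (V : normedModType R) (f : V -> R)
    (x u v : V) :
  (\forall y \near x, [/\ differentiable f y, differentiable ('D_u f) y &
                          differentiable ('D_v f) y]) ->
  {for x, continuous ('D_v ('D_u f))} -> {for x, continuous ('D_u ('D_v f))} ->
  'D_v ('D_u f) x = 'D_u ('D_v f) x.
Proof.
move=> df cuv cvu.
suff small e : 0 < e -> `|'D_v ('D_u f) x - 'D_u ('D_v f) x| <= e + e.
  apply/eqP; rewrite -subr_eq0 -normr_le0; apply/ler_addgt0Pl => e e0.
  by rewrite addr0 [e in _ <= e]splitr; apply: small; rewrite divr_gt0.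
move=> e0.
have H1 : \forall y \near x, `|'D_v ('D_u f) x - 'D_v ('D_u f) y| <= e.
  exact: (cvgr_dist_le _ _ cuv _ e0).
have H2 : \forall y \near x, `|'D_u ('D_v f) x - 'D_u ('D_v f) y| <= e.
  exact: (cvgr_dist_le _ _ cvu _ e0).
have [d /= d0 Hd] := (@nbhs_ballP R V _ _).1 (filterI df (filterI H1 H2)).
(* With this [s] the whole parallelogram spanned by [s *: u] and [s *: v] at [x] lies in the ball of
   radius [d]. *)
pose s := d / (`|u| + `|v| + 1).
have k0 : 0 < `|u| + `|v| + 1 by rewrite ltr_wpDl// addr_ge0.
have s0 : 0 < s by rewrite divr_gt0.
have inb a b : 0 <= a <= s -> 0 <= b <= s -> ball x d (x + a *: u + b *: v).
  move=> /andP[a0 as_] /andP[b0 bs];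
    rewrite -ball_normE/= opprD addrA opprD addrA subrr sub0r -opprD normrN.
  apply: (le_lt_trans (ler_normD _ _)); rewrite !normrZ !ger0_norm//.
  apply: (@le_lt_trans _ _ (s * (`|u| + `|v|))).
    by rewrite mulrDr lerD// ler_wpM2r.
  by rewrite /s mulrAC ltr_pdivrMr// ltr_pM2l// ltrDl.
have [a [b [ha hb E1]]] := @second_difference R V f x u v s s0
  (fun a b ha hb => let: conj (And3 x1 x2 _) _ := Hd _ (inb a b ha hb) in conj x1 x2).
have inb' a' b' : 0 <= a' <= s -> 0 <= b' <= s -> ball x d (x + a' *: v + b' *: u).
  by move=> ? ?; rewrite addrAC; exact: inb.
have [a' [b' [ha' hb' E2]]] := @second_difference R V f x v u s s0
  (fun a b ha hb => let: conj (And3 x1 _ x2) _ := Hd _ (inb' a b ha hb) in conj x1 x2).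
(* Both mixed derivatives come from the same second difference, which is symmetric in [u] and
   [v]. *)
have E3 : 'D_v ('D_u f) (x + a *: u + b *: v) = 'D_u ('D_v f) (x + a' *: v + b' *: u).
  apply: (@mulfI _ (s ^+ 2)); first by rewrite expf_neq0// gt_eqF.
  apply: etrans (esym E1) (etrans _ E2).
  rewrite (addrAC x (s *: v)); congr (_ + f x); exact: addrAC.
have [_ [h1 _]] := Hd _ (inb a b ha hb).
have [_ [_ h2]] := Hd _ (inb' a' b' ha' hb').
move: E3 h1 h2; move: ('D_v _ _) ('D_u _ _) ('D_v _ _) ('D_u _ _) => p q r r' <-.
move=> pr qr; apply: le_trans (ler_distD r p q) (lerD pr _).
by rewrite distrC.
Qed.

(** Schwarz's theorem, one direction of [vs] at a time. It serves to move a time derivative past the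
    space derivatives of a jet. *)
Lemma iter_deriv_comm (R : realType) (V : normedModType R) (D : set V)
    (f : V -> R) (u : V) (vs : seq V) (x : V) :
  open D -> smooth_on D f -> D x ->
  'D_u (iter_deriv vs f) x = iter_deriv vs ('D_u f) x.
Proof.
move=> oD sf; elim: vs x => [//|v vs IH] x Dx /=.
rewrite derive_comm.
- apply: near_eq_derive; near=> y; apply: IH; near: y; exact: open_nbhs_nbhs.
- near=> y; have Dy : D y by near: y; exact: open_nbhs_nbhs.
  by split; [exact: (sf vs)|exact: (sf (v :: vs))|exact: (sf (u :: vs))].
- exact: (differentiable_continuous (sf [:: u, v & vs] x Dx)).
- exact: (differentiable_continuous (sf [:: v, u & vs] x Dx)).
Unshelve. all: by end_near. Qed.

Lemma iter_deriv_slice (R : realType) (V X : normedModType R)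
    (F : R * V -> X) (vs : seq V) (t : R) (x : V) :
  iter_deriv vs (fun y => F (t, y)) x =
  iter_deriv [seq (0, v) | v <- vs] F (t, x).
Proof.
elim: vs x => [//|v vs IH] x /=.
have -> : iter_deriv vs (fun y => F (t, y)) =
    iter_deriv [seq (0, v) | v <- vs] F \o pair t by apply/funext => y; rewrite /= -IH.
apply: derive_affine => h; apply/pair_equal_spec; split => //=.
by rewrite /= scaler0 add0r.
Qed.

Lemma eq_iter_deriv (R : realType) (V X : normedModType R) (D : set V)
    (f g : V -> X) (vs : seq V) (x : V) :
  open D -> {in D, f =1 g} -> D x -> iter_deriv vs f x = iter_deriv vs g x.
Proof.
move=> oD fg; elim: vs x => [x Dx|v vs IH x Dx] /=.
  by apply: fg; rewrite inE.
apply: near_eq_derive; near=> y; apply: IH; near: y; exact: open_nbhs_nbhs.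
Unshelve. all: by end_near. Qed.

(** Extended by its limit [l] to the left of 0, [f] becomes continuous on some [[0, b]]; the
    integral from 0 of this extension is the antiderivative. *)
Lemma antiderivative_at_right (R : realType) (f : R -> R) (l : R) :
  f t @[t --> 0^'+] --> l ->
  (\forall t \near (0 : R)^'+, {for t, continuous f}) ->
  exists F : R -> R, [/\ F 0 = 0, F t @[t --> 0^'+] --> (0 : R) &
    \forall t \near (0 : R)^'+, is_derive t (1 : R) F (f t)].
Proof.
move=> fl [e /= e0 cf]; pose b := e / 2; have b0 : 0 < b by rewrite divr_gt0.
have be : b < e by rewrite ltr_pdivrMr// ltr_pMr// ltr1n.
have {}cf t : 0 < t -> t <= b -> {for t, continuous f}.
  move=> t0 tb; apply: cf => //=.
  by rewrite sub0r normrN gtr0_norm// (le_lt_trans tb).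
pose g t := if t <= 0 then l else f t.
have gf t : 0 < t -> g t = f t by rewrite /g leNgt => ->.
have cg t : 0 < t -> t <= b -> {for t, continuous g}.
  move=> t0 tb; change (g z @[z --> t] --> g t); rewrite (gf t t0).
  apply: cvg_trans (cf t t0 tb); apply: near_eq_cvg; near=> z.
  by rewrite gf//; near: z; exact: lt_nbhsr.
have g0 : g 0 = l by rewrite /g lexx.
have wg : {within `[0, b], continuous g}.
  apply/continuous_within_itvP => //; split.
  - by move=> t /[!in_itv]/= /andP[t0 tb]; apply: cg => //; exact: ltW.
  - rewrite g0; apply: cvg_trans fl; apply: near_eq_cvg; near=> z.
    by rewrite gf.
  - by apply: cvg_at_left_filter; exact: cg.
have ig : lebesgue_measure.-integrable `[0, b] (EFin \o g).
  by apply: continuous_compact_integrable => //; exact: segment_compact.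
pose F t := (\int[lebesgue_measure]_(x in `[0, t]) g x)%R.
have F0 : F 0 = 0 by rewrite /F set_itv1 Rintegral_set1.
exists F; split => //.
  have /(continuous_within_itvP _ b0)[_ + _] :=
    parameterized_integral_continuous (ltW b0) ig.
  by rewrite /parameterized_integral -/(F 0) F0.
near=> t.
have t0 : 0 < t by [].
have tb : t < b by near: t; exact: nbhs_right_lt.
have [dF FE] := continuous_FTC1_closed tb ig t0 (cg t t0 (ltW tb)).
by apply: DeriveDef => //; rewrite -gf// -FE derive1E.
Unshelve. all: by end_near. Qed.

(** * Runge-Kutta order for finite systems *)

Lemma row_as_sum (R : realType) T n (f : T -> 'rV[R]_n) :
  f = fun t => \sum_(j < n) f t 0 j *: delta_mx 0 j.
Proof. by apply/funext => t; exact: row_sum_delta. Qed.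

Lemma coord_norm_le (R : realType) m n (M : 'M[R]_(m, n)) i j : `|M i j| <= `|M|.
Proof. by rewrite [leRHS]/Num.Def.normr/= mx_normrE; exact: (le_bigmax _ _ (i, j)). Qed.

(** The differential of [f] serves for [g] as well, since the remainder only sees values near
    [x]. *)
Lemma near_eq_differentiable (R : realType) (V W : normedModType R)
    (f g : V -> W) (x : V) :
  (\forall y \near x, f y = g y) -> differentiable f x -> differentiable g x.
Proof.
move=> fg df; have gE : g \o shift x = cst (g x) + 'd f x +o_ 0 id.
  apply/eqaddoP => e e0.
  have /eqaddoP/(_ e e0) := diff_locally df.
  have : \forall h \near 0, f (h + x) = g (h + x).
    by move: fg; rewrite (near_shift 0) subr0.
  apply: filterS2 => h fgh.
  by rewrite !fctE /= fgh (nbhs_singleton fg).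
have dgE := diff_unique (diff_continuous df) gE.
by apply/diff_locallyP; rewrite dgE; split => //; exact: diff_continuous.
Qed.

Lemma cvg_row (R : realType) T (F : set_system T) {FF : Filter F} n
    (f : T -> 'rV[R]_n) (l : 'rV[R]_n) :
  (forall j, f t 0 j @[t --> F] --> l 0 j) -> f t @[t --> F] --> l.
Proof.
move=> fl; rewrite (row_as_sum f) [l]row_sum_delta.
by apply: cvg_big => [|j _]; [exact: add_continuous|apply: cvgZr_tmp; exact: fl].
Qed.

Lemma differentiable_row (R : realType) (V : normedModType R) n
    (f : V -> 'rV[R]_n) (x : V) :
  (forall j, differentiable (fun y => f y 0 j) x) -> differentiable f x.
Proof.
move=> df; rewrite (row_as_sum f).
have := @differentiable_sum R V 'rV[R]_n n (fun j y => f y 0 j *: delta_mx 0 j) x.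
rewrite (_ : \sum_(j < n) (fun y => f y 0 j *: delta_mx 0 j) =
  fun t => \sum_(j < n) f t 0 j *: delta_mx 0 j); last first.
  by apply/funext => t; rewrite fct_sumE.
apply=> j; exact: differentiableZl.
Qed.

Lemma iter_deriv_cst (R : realType) (V W : normedModType R) (vs : seq V) (c : W) :
  exists c' : W, iter_deriv vs (fun _ : V => c) = fun _ => c'.
Proof.
elim: vs => [|v vs [c' IH]] /=; first by exists c.
by exists 0; apply/funext => x; rewrite IH; exact: derive_cst.
Qed.

(** [imex_order] speaks of row vectors; families indexed by a finite type are carried over to it by
    enumeration. *)
Definition pack (R : realType) (K : finType) (r : K -> R) : 'rV[R]_#|K| :=
  \row_j r (enum_val j).

Definition unpack (R : realType) (K : finType) (y : 'rV[R]_#|K|) : K -> R :=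
  fun k => y 0 (enum_rank k).

Lemma packK (R : realType) (K : finType) (r : K -> R) : unpack (pack r) = r.
Proof. by apply/funext => k; rewrite /unpack mxE enum_rankK. Qed.

Lemma unpack_differentiable (R : realType) (K : finType) (y : 'rV[R]_#|K|) k :
  differentiable (fun z => unpack z k) y.
Proof. exact: differentiable_coord. Qed.

(** Every iterated derivative of the vector field is again given by terms, with no smaller domain;
    this is how smoothness of the field is obtained. *)
Lemma iter_deriv_system (R : realType) (K : finType) (rhs : K -> expr R K) (vs : seq 'rV[R]_#|K|) :
  open [set y | forall k, edom (rhs k) (unpack y)] ->
  exists E : K -> expr R K,
    forall y, (forall k, edom (rhs k) (unpack y)) ->
      (forall k, edom (E k) (unpack y)) /\
      iter_deriv vs (fun y => pack (fun k => eeval (rhs k) (unpack y))) y =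
        pack (fun k => eeval (E k) (unpack y)).
Proof.
move=> oD; elim: vs => [|v vs [E HE]] /=; first by exists rhs.
(* Moving along [v] changes the variable [k'] at the constant rate [unpack v k']. *)
pose del k' : expr R K := Cst (unpack v k').
exists (fun k => ediff del (E k)) => y Dy; have [dE _] := HE y Dy.
split=> [k|]; first exact: edom_ediff.
have dE' k := eval_differentiable (unpack_differentiable y) (dE k).
rewrite (@near_eq_derive _ _ _ _ (fun y => pack (fun k => eeval (E k) (unpack y)))).
  rewrite derive_mx.
    apply/rowP => j; rewrite !mxE; under eq_fun do rewrite mxE.
    apply: eval_derive => // [k|k]; first exact: unpack_differentiable.
    have /matrixP/(_ 0 (enum_rank k)) := derive_mx (@derivable_id R _ y v).
    by rewrite derive_id mxE => <-.
  apply/derivable_mxP => i j; apply: diff_derivable.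
  by under eq_fun do rewrite mxE.
near=> z; apply: (HE z _).2; near: z; exact: open_nbhs_nbhs.
Unshelve. all: by end_near. Qed.

(** The limiting scheme is purely implicit, so [imex_order] is used with explicit field 0 and the
    packed [rhs] as implicit field. Solution and stages are given, so no existence result enters. *)
Lemma imex_order_system (R : realType) (K : finType) s (M : imex_tableau R s) p
    (rhs : K -> expr R K)
    (z0 : K -> R) (z : R -> K -> R) (Z : R -> 'I_s -> K -> R) :
  imex_order M p ->
  (forall k, edom (rhs k) z0) ->
  z 0 = z0 -> (forall k, z t k @[t --> 0^'+] --> z0 k) ->
  (\forall t \near (0 : R)^'+, forall k,
    is_derive t (1 : R) (fun t => z t k) (eeval (rhs k) (z t))) ->
  (forall i k, Z dt i k @[dt --> 0^'+] --> z0 k) ->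
  (\forall dt \near (0 : R)^'+, forall i k,
    Z dt i k = z0 k
      + dt * \sum_(j < s | (j <= i)%N) im_mx M i j * eeval (rhs k) (Z dt j)) ->
  forall k, bigO_pow p.+1 (fun dt =>
    z0 k + dt * (\sum_(j < s) im_wt M 0 j * eeval (rhs k) (Z dt j)) - z dt k).
Proof.
move=> oM dz0 z0E cz Dz cZ HZ k.
pose D := [set y : 'rV[R]_#|K| | forall k, edom (rhs k) (unpack y)].
pose g (y : 'rV[R]_#|K|) := pack (fun k => eeval (rhs k) (unpack y)).
have oD : open D.
  rewrite openE => y Dy.
  suff : \forall y' \near y, forall k, edom (rhs k) (unpack y') by [].
  apply: (@filter_forall _ K (fun k y' => edom (rhs k) (unpack y')) (nbhs y)) => k'.
  apply: (@near_edom _ _ (nbhs y) _ _ _ (@unpack R K) _ _ (Dy k')) => k''.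
  exact: (differentiable_continuous (unpack_differentiable y k'')).
have sg : smooth_on D g.
  move=> vs y Dy; have [E HE] := iter_deriv_system vs oD.
  have [dE _] := HE y Dy.
  apply: (near_eq_differentiable (f := fun y => pack (fun k => eeval (E k) (unpack y)))).
    near=> z'; apply/esym/(HE z' _).2; near: z'; exact: open_nbhs_nbhs.
  apply: differentiable_row => j; under eq_fun do rewrite mxE.
  by apply: eval_differentiable => // ?; exact: unpack_differentiable.
have s0 : smooth_on D (fun=> 0 : 'rV[R]_#|K|).
  move=> vs y _; have [c ->] := iter_deriv_cst vs (0 : 'rV[R]_#|K|).
  exact: differentiable_cst.
have Dzt : \forall t \near (0 : R)^'+, forall k, edom (rhs k) (z t).
  apply: (@filter_forall _ K (fun k t => edom (rhs k) (z t)) (0^'+)) => k'.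
  exact: near_edom (dz0 k').
(* [e] is the final time passed to [imex_order]: on []0, e[] both the domain condition and the
   differential equation hold. *)
have [e /= e0 He] := filterI Dzt Dz.
pose y t := pack (z t).
pose y1 dt := pack (fun k => z0 k + dt * \sum_(j < s) im_wt M 0 j * eeval (rhs k) (Z dt j)).
have := oM #|K| D (fun=> 0) g e y (fun dt i => pack (Z dt i)) y1 oD s0 sg e0.
have cpack (u : R -> K -> R) : (forall k, u t k @[t --> 0^'+] --> z0 k) ->
    pack (u t) @[t --> 0^'+] --> y 0.
  move=> cu; apply: cvg_row => j; rewrite /y /pack mxE z0E.
  by under eq_fun do rewrite mxE; exact: cu.
case.
- by move=> k'; rewrite packK z0E.
- exact: cpack.
- move=> t /andP[t0 te].
  have [|D1 D2] := He t _ t0; first by rewrite /= sub0r normrN gtr0_norm.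
  split; first by move=> k'; rewrite packK.
  have dy : derivable y t 1.
    by apply/derivable_mxP => i j; under eq_fun do rewrite mxE; have [] := D2 (enum_val j).
  apply: DeriveDef => //; rewrite derive_mx// add0r; apply/rowP => j.
  rewrite !mxE packK; under eq_fun do rewrite mxE.
  by have [] := D2 (enum_val j).
- by move=> i; exact: cpack.
- apply: filterS HZ => dt HZ; split=> [i|].
    rewrite [X in _ + _ *: X + _]big1 ?scaler0 ?addr0; last by move=> j _; rewrite scaler0.
    apply/rowP => j; rewrite !mxE z0E HZ summxE; congr (_ + _ * _).
    by apply: eq_bigr => j' _; rewrite !mxE packK.
  rewrite [X in _ + _ *: X + _]big1 ?scaler0 ?addr0; last by move=> j _; rewrite scaler0.
  apply/rowP => j; rewrite !mxE z0E summxE; congr (_ + _ * _).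
  by apply: eq_bigr => j' _; rewrite !mxE packK.
move=> C HC; exists C; apply: filterS HC => dt; apply: le_trans.
have := coord_norm_le (y1 dt - y dt) 0 (enum_rank k).
by rewrite !mxE enum_rankK.
Unshelve. all: by end_near. Qed.

(** * Picard iterates *)

(** What one Picard integration asks of its input and returns in its output. *)
Definition right_regular (R : realType) (B : Type) (u0 : B -> R)
    (z : R -> B -> R) : Prop :=
  [/\ z 0 = u0, forall b, z t b @[t --> 0^'+] --> u0 b &
      forall b, \forall t \near (0 : R)^'+, {for t, continuous (fun t => z t b)}].

Lemma picard_iterates (R : realType) (B : finType) (rhs : B -> expr R B)
    (u0 : B -> R) :
  (forall b, edom (rhs b) u0) ->
  exists z : nat -> R -> B -> R,
    [/\ z 0%N = (fun _ => u0), forall k, right_regular u0 (z k) &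
        forall k b, \forall t \near (0 : R)^'+,
          is_derive t (1 : R) (fun t => z k.+1 t b) (eeval (rhs b) (z k t))].
Proof.
move=> d0.
(* The step is made total, so that choice turns it into a function that can be iterated; an
   irregular [z] is sent to itself. *)
have step z : exists z', right_regular u0 z -> right_regular u0 z' /\
    forall b, \forall t \near (0 : R)^'+,
      is_derive t (1 : R) (fun t => z' t b) (eeval (rhs b) (z t)).
  have [[z0 cz nz]|nr] := pselect (right_regular u0 z); last by exists z.
  have /choice[F HF] : forall b, exists F : R -> R,
      [/\ F 0 = 0, F t @[t --> 0^'+] --> (0 : R) &
          \forall t \near (0 : R)^'+, is_derive t (1 : R) F (eeval (rhs b) (z t))].
    move=> b; apply: (@antiderivative_at_right _ _ (eeval (rhs b) u0)).
      exact: eval_cvg.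
    have n1 : \forall t \near (0 : R)^'+, edom (rhs b) (z t) by exact: near_edom (d0 b).
    have n2 := @filter_forall _ B (fun b t => {for t, continuous (z^~ b)}) (0^'+) _ nz.
    near=> t.
    have ct : forall b, {for t, continuous (z^~ b)} by near: t; exact: n2.
    apply: (@eval_cvg _ _ (nbhs t) _ _ _ (fun t => z t) (z t)).
      by move=> b'; exact: ct.
    by near: t.
  exists (fun t b => u0 b + F b t) => _.
  have Dz' b : \forall t \near (0 : R)^'+,
      is_derive t (1 : R) (fun t => u0 b + F b t) (eeval (rhs b) (z t)).
    have [_ _] := HF b; apply: filterS => t DF.
    by rewrite -[X in is_derive _ _ _ X]add0r; exact: is_deriveD.
  split=> //; split=> [|b|b].
  - by apply/funext => b; have [-> _ _] := HF b; rewrite addr0.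
  - rewrite -[X in _ --> X]addr0; apply: cvgD; first exact: cvg_cst.
    by have [] := HF b.
  - apply: filterS (Dz' b) => t [+ _] => /derivable1_diffP.
    exact: differentiable_continuous.
have /choice[S HS] := step.
exists (fun k => iter k S (fun _ => u0)).
have reg k : right_regular u0 (iter k S (fun _ => u0)).
  elim: k => [|k IH] /=; last by have [] := HS _ IH.
  split=> // b; first exact: cvg_cst.
  by apply: nearW => t; exact: cst_continuous.
by split=> // k b /=; have [_] := HS _ (reg k); exact.
Unshelve. all: by end_near. Qed.

(** Fixed-point iteration for the implicit stage equations, the discrete counterpart of the Picard
    iterates. Each level uses the stage derivatives of the level below, so the values are
    explicit. *)
Fixpoint stage_iterates (R : realType) s (M : imex_tableau R s) (B : Type)
    (rhs : B -> expr R B) (u0 : B -> R) (k : nat) (dt : R) (i : 'I_s) (b : B) : R :=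
  if k is k'.+1 then
    u0 b + dt * \sum_(j < s | (j <= i)%N)
      im_mx M i j * eeval (rhs b) (stage_iterates M rhs u0 k' dt j)
  else u0 b.

Lemma stage_iterates_cvg (R : realType) s (M : imex_tableau R s) (B : Type)
    (rhs : B -> expr R B) (u0 : B -> R) (k : nat) (i : 'I_s) (b : B) :
  (forall b, edom (rhs b) u0) ->
  stage_iterates M rhs u0 k dt i b @[dt --> 0^'+] --> u0 b.
Proof.
move=> d0; elim: k i b => [|k IH] i b /=; first exact: cvg_cst.
rewrite -[X in _ --> X]addr0; apply: cvgD; first exact: cvg_cst.
rewrite -[X in _ --> X](mul0r (\sum_(j < s | (j <= i)%N) im_mx M i j * eeval (rhs b) u0)).
apply: cvgM; first exact: (cvg_at_right_filter (@cvg_id _ _)).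
apply: cvg_big => [|j _]; first exact: add_continuous.
by apply: cvgM; [exact: cvg_cst|apply: eval_cvg => // b'; exact: IH].
Qed.

(** Levels 0 to [p] as one triangular system, each level driven by the one below; [inord k'] is in
    range because [k'] precedes the index of a level. *)
Definition cascade (R : realType) p (B : Type) (rhs : B -> expr R B)
    (kb : 'I_p.+1 * B) : expr R ('I_p.+1 * B)%type :=
  if val kb.1 is k'.+1 then esubst (fun b => Var (inord k', b)) (rhs kb.2)
  else Cst 0.

Definition cascade_rhs (R : realType) (B : Type) (rhs : B -> expr R B)
    (u : nat -> B -> R) (k : nat) (b : B) : R :=
  if k is k'.+1 then eeval (rhs b) (u k') else 0.

Lemma eeval_cascade (R : realType) p (B : Type) (rhs : B -> expr R B)
    (u : nat -> B -> R) (kb : 'I_p.+1 * B) :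
  eeval (cascade rhs kb) (fun kb => u kb.1 kb.2) = cascade_rhs rhs u kb.1 kb.2.
Proof.
case: kb => -[[|k] lek] b; rewrite /cascade //= eval_esubst /=.
by congr (eeval _ _); apply/funext => b' /=; rewrite inordK// ltnW.
Qed.

Lemma edom_cascade (R : realType) p (B : Type) (rhs : B -> expr R B)
    (u0 : B -> R) (kb : 'I_p.+1 * B) :
  (forall b, edom (rhs b) u0) -> edom (cascade rhs kb) (fun kb => u0 kb.2).
Proof. by move=> d0; rewrite /cascade; case: (val kb.1) => //= k; exact: edom_esubst. Qed.

(** The Picard iterates solve the cascade exactly and [stage_iterates] are its Runge-Kutta stages,
    so the order for finite systems applies; the conclusion is its component at the top level
    [p]. *)
Lemma cascade_order (R : realType) s (M : imex_tableau R s) p (B : finType)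
    (rhs : B -> expr R B) (u0 : B -> R) (z : nat -> R -> B -> R) (b : B) :
  imex_order M p -> (forall b, edom (rhs b) u0) ->
  z 0%N = (fun _ => u0) -> (forall k, right_regular u0 (z k)) ->
  (forall k b, \forall t \near (0 : R)^'+,
    is_derive t (1 : R) (fun t => z k.+1 t b) (eeval (rhs b) (z k t))) ->
  bigO_pow p.+1 (fun dt => u0 b + dt * (\sum_(j < s) im_wt M 0 j *
    cascade_rhs rhs (fun k => stage_iterates M rhs u0 k dt j) p b) - z p dt b).
Proof.
move=> oM d0 z0 rz Dz.
pose Z dt i (kb : 'I_p.+1 * B) := stage_iterates M rhs u0 kb.1 dt i kb.2.
have := @imex_order_system R ('I_p.+1 * B)%type s M p (cascade rhs) (fun kb => u0 kb.2)
  (fun t kb => z kb.1 t kb.2) Z oM (fun kb => edom_cascade kb d0) _ _ _ _ _ (ord_max, b).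
have ZE dt j kb : eeval (cascade rhs kb) (Z dt j) =
    cascade_rhs rhs (fun k => stage_iterates M rhs u0 k dt j) kb.1 kb.2.
  exact: (eeval_cascade rhs (fun k b => stage_iterates M rhs u0 k dt j b)).
move=> H; apply: eq_near_bigO (H _ _ _ _ _) => {H}.
- by apply: nearW => dt; under eq_bigr do rewrite ZE.
- by apply/funext => -[k b'] /=; have [-> _ _] := rz k.
- by move=> -[k b'] /=; have [_ + _] := rz k; exact.
- pose Q (kb : 'I_p.+1 * B) t := is_derive t (1 : R) (fun t => z kb.1 t kb.2)
      (eeval (cascade rhs kb) (fun kb => z kb.1 t kb.2)).
  apply: (@filter_forall _ _ Q (0^'+)) => -[[k lek] b'].
  have QE t := eeval_cascade rhs (fun k => z k t) (Ordinal lek, b').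
  case: k lek QE => [|k] lek QE; near=> t; rewrite /Q QE /=.
    by rewrite z0; exact: is_derive_cst.
  by near: t; exact: Dz.
- by move=> i kb; exact: stage_iterates_cvg.
- apply: nearW => dt i [[k lek] b'].
  under eq_bigr do rewrite ZE.
  case: k lek => [|k] lek; rewrite /Z //= big1 ?mulr0 ?addr0// => j _.
  by rewrite mulr0.
Unshelve. all: by end_near. Qed.

(** * Runge-Kutta order for jet systems *)

(** Words longer than [m] are frozen at their initial value, which leaves finitely many unknowns
    when the alphabet is finite. *)
Definition trunc_var (R : realType) (A : Type) m (u0 : seq A -> R) (w : seq A) :
    expr R (m.-bseq A) :=
  if insub w is Some b then Var b else Cst (u0 w).

Definition trunc_env (R : realType) (A : Type) m (u0 : seq A -> R)
    (u : m.-bseq A -> R) (w : seq A) : R :=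
  if insub w is Some b then u b else u0 w.

Lemma eeval_trunc (R : realType) (A : Type) m (u0 : seq A -> R)
    (E : expr R (seq A)) (u : m.-bseq A -> R) :
  eeval (esubst (trunc_var m u0) E) u = eeval E (trunc_env u0 u).
Proof.
rewrite eval_esubst; congr eeval; apply/funext => w.
by rewrite /trunc_var /trunc_env; case: insub.
Qed.

Lemma trunc_env_cvg (R : realType) T (F : set_system T) {FF : Filter F}
    (A : Type) m (u0 : seq A -> R) (u : T -> m.-bseq A -> R) (w : seq A) :
  (forall b : m.-bseq A, u t b @[t --> F] --> u0 b) ->
  trunc_env u0 (u t) w @[t --> F] --> u0 w.
Proof.
move=> cu; rewrite /trunc_env; case: insubP => [b _ <-|_]; first exact: cu.
exact: cvg_cst.
Qed.

(* Level [k] is accurate for the words of length at most [m - 2 * k] only, since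
   each level loses two letters to the truncation at length [m]. *)
Lemma jets_order (R : realType) (A : finType) s (M : imex_tableau R s) p
    (E : seq A -> expr R (seq A)) (J0 : seq A -> R) (J : R -> seq A -> R)
    (H : R -> 'I_s -> seq A -> R) (w : seq A) :
  imex_order M p ->
  (forall w, evars (fun w' => (size w' <= size w + 2)%N) (E w)) ->
  (forall w, edom (E w) J0) ->
  (forall w, J t w @[t --> 0^'+] --> J0 w) ->
  (forall w, \forall t \near (0 : R)^'+,
     is_derive t (1 : R) (fun t => J t w) (eeval (E w) (J t))) ->
  (forall i w, H dt i w @[dt --> 0^'+] --> J0 w) ->
  (forall i w, \forall dt \near (0 : R)^'+,
     H dt i w = J0 w + dt * \sum_(j < s | (j <= i)%N) im_mx M i j * eeval (E w) (H dt j)) ->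
  bigO_pow p.+1 (fun dt =>
    J0 w + dt * (\sum_(j < s) im_wt M 0 j * eeval (E w) (H dt j)) - J dt w).
Proof.
move=> oM vE dE cJ DJ cH HH.
(* Room for [p] levels at two letters each, so that level [p] is still accurate at [w]. *)
pose m := (size w + 2 * p)%N.
pose rhs (b : m.-bseq A) := esubst (trunc_var m J0) (E b).
pose u0 (b : m.-bseq A) := J0 b.
have d0 b : edom (rhs b) u0.
  apply: edom_esubst => [w'|]; first by rewrite /trunc_var; case: insub.
  suff -> : (fun w' => eeval (trunc_var m J0 w') u0) = J0 by exact: dE.
  by apply/funext => w'; rewrite /trunc_var; case: insubP => // b' _ <-.
have [z [z0 rz Dz]] := picard_iterates d0.
pose Z k dt i := stage_iterates M rhs u0 k dt i.
(* The variables of [E b] have at most [size b + 2] letters: none is frozen, and all lie in the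
   range where level [k] is accurate. *)
have diff_rhs n (u : R -> seq A -> R) (v : R -> m.-bseq A -> R) (b : m.-bseq A) k :
    (forall w, u t w @[t --> 0^'+] --> J0 w) ->
    (forall b', v t b' @[t --> 0^'+] --> u0 b') ->
    (size b + 2 * k.+1 <= m)%N ->
    (forall b' : m.-bseq A, (size b' + 2 * k <= m)%N ->
       bigO_pow n (fun t => u t b' - v t b')) ->
    bigO_pow n (fun t => eeval (E b) (u t) - eeval (rhs b) (v t)).
  move=> cu cv bm uv; rewrite /rhs.
  apply: (eq_near_bigO (u := fun t => eeval (E b) (u t) - eeval (E b) (trunc_env J0 (v t)))).
    by apply: nearW => t; rewrite eeval_trunc.
  apply: (eval_bigO _ _ _ (dE b) (vE b)) => // [w'|w' w'b].
    exact: trunc_env_cvg.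
  rewrite /trunc_env; case: insubP => [b' _ b'E|]; last by lia.
  by rewrite -b'E; apply: uv; rewrite b'E; lia.
(* The factor [dt] of the stage equation turns order [k] for the stage derivatives into order [k.+1]
   for the stages. *)
have numD k (b : m.-bseq A) i : (size b + 2 * k <= m)%N ->
    (forall j, bigO_pow k (fun dt =>
      eeval (E b) (H dt j) - cascade_rhs rhs (fun k => Z k dt j) k b)) ->
    bigO_pow k.+1 (fun dt => H dt i b - Z k dt i b).
  move=> bm DD.
  apply: (eq_near_bigO (u := fun dt => dt * \sum_(j < s | (j <= i)%N) im_mx M i j *
        (eeval (E b) (H dt j) - cascade_rhs rhs (fun k => Z k dt j) k b))).
    apply: filterS (HH i b) => dt ->.
    under eq_bigr do rewrite mulrBr.
    rewrite sumrB mulrBr /Z; case: (k) => [|k'] /=;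
      last by rewrite opprD addrACA subrr add0r.
    by rewrite [X in _ - dt * X]big1 => [|j _]; rewrite ?mulr0// subr0 addrAC subrr add0r.
  apply: (@bigOM _ 1 k) => //; first exact: bigO_id.
  by apply: bigO_sum => j _; apply: bigOZ.
have numE k : forall (b : m.-bseq A) j, (size b + 2 * k <= m)%N ->
    bigO_pow k (fun dt => eeval (E b) (H dt j) - cascade_rhs rhs (fun k => Z k dt j) k b).
  elim: k => [|k IH] b j bm /=.
    apply: (eq_near_bigO (u := fun dt => eeval (E b) (H dt j))).
      by apply: nearW => dt; rewrite subr0.
    by apply: (@bigO_bounded _ _ _ (eeval (E b) J0)); exact: eval_cvg.
  apply: (diff_rhs _ _ _ _ k) => // [b'|b' b'm]; first exact: stage_iterates_cvg.
  by apply: numD => // j'; exact: IH.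
(* The same gain for the exact jets, now by integration in time. *)
have exaD k (b : m.-bseq A) :
    bigO_pow k (fun t => eeval (E b) (J t) - cascade_rhs rhs (fun k => z k t) k b) ->
    bigO_pow k.+1 (fun t => J t b - z k t b).
  move=> DD; apply: bigO_derive DD.
    rewrite -[X in _ --> X](subrr (J0 b)); apply: cvgB; first exact: cJ.
    by have [_ + _] := rz k; exact.
  have DJb := DJ b; case: k => [|k]; near=> t.
    rewrite z0; apply: is_deriveB; first by near: t.
    exact: is_derive_cst.
  apply: is_deriveB; near: t => //; exact: Dz.
have exaE k : forall b : m.-bseq A, (size b + 2 * k <= m)%N ->
    bigO_pow k (fun t => eeval (E b) (J t) - cascade_rhs rhs (fun k => z k t) k b).
  elim: k => [|k IH] b bm /=.
    apply: (eq_near_bigO (u := fun t => eeval (E b) (J t))).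
      by apply: nearW => t; rewrite subr0.
    by apply: (@bigO_bounded _ _ _ (eeval (E b) J0)); exact: eval_cvg.
  apply: (diff_rhs _ _ _ _ k) => // [b'|b' b'm]; first by have [_ + _] := rz k; exact.
  by apply: exaD; exact: IH.
have wm : (size w <= m)%N by rewrite leq_addr.
pose b : m.-bseq A := Bseq wm.
have := cascade_order b oM d0 z0 rz Dz => casc.
(* The update is compared with the update of the cascade, that one with the Picard iterate of level
   [p], and the iterate with the exact jet. *)
apply: bigOB_trans (bigOBC (exaD p b (exaE p b (leqnn _)))).
apply: bigOB_trans casc.
apply: (eq_near_bigO (u := fun dt => dt * \sum_(j < s) im_wt M 0 j *
        (eeval (E b) (H dt j) - cascade_rhs rhs (fun k => Z k dt j) p b))).
  apply: nearW => dt; under eq_bigr do rewrite mulrBr.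
  by rewrite sumrB mulrBr opprD addrACA subrr add0r.
apply: (@bigOM _ 1 p) => //; first exact: bigO_id.
by apply: bigO_sum => j _; apply: bigOZ; exact: numE.
Unshelve. all: by end_near. Qed.

(** * Jets of the limiting flux *)

Definition jet (R : realType) d (f : 'rV[R]_d -> R) (w : seq 'I_d) :
    'rV[R]_d -> R :=
  iter_deriv [seq delta_mx 0 i | i <- w] f.

(* Jet variables: [(false, w)] for the depth and [(true, w)] for the bottom. *)
Definition jet_env (R : realType) d (h b : 'rV[R]_d -> R) (x : 'rV[R]_d)
    (v : bool * seq 'I_d) : R :=
  jet (if v.1 then b else h) v.2 x.

(** The rule on variables of the total derivative in direction [i]: one more letter in the word. *)
Definition jet_shift (R : realType) d (i : 'I_d) (v : bool * seq 'I_d) :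
    expr R (bool * seq 'I_d) :=
  Var (v.1, i :: v.2).

Definition surface_expr (R : realType) d (i : 'I_d) : expr R (bool * seq 'I_d) :=
  Add (Var (false, [:: i])) (Var (true, [:: i])).

Definition slope_expr (R : realType) d : expr R (bool * seq 'I_d) :=
  \big[@Add R _/Cst 0]_(i < d) Mul (surface_expr R i) (surface_expr R i).

(** [slope_expr] is the square of the norm of grad H, so the exponents 1/2, 1/2 and -1 yield the
    inverse of the root of the norm. The domain thus forces grad H to be nonzero, at points where
    the variables are genuine jets. *)
Definition flux_expr (R : realType) d (P : swe_data R d) (i : 'I_d) :
    expr R (bool * seq 'I_d) :=
  Mul (Pow 2^-1 (Mul (Pow (eta P + 1) (Var (false, [::]))) (Cst (mann P ^+ 2)^-1)))
    (Mul (Pow (-1) (Pow 2^-1 (Pow 2^-1 (slope_expr R d)))) (surface_expr R i)).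

Definition div_flux_expr (R : realType) d (P : swe_data R d) :
    expr R (bool * seq 'I_d) :=
  \big[@Add R _/Cst 0]_(i < d) ediff (@jet_shift R d i) (flux_expr P i).

(** Under the limiting equation this is the time derivative of the depth jet [w]. *)
Definition jet_rhs (R : realType) d (P : swe_data R d) (w : seq 'I_d) :
    expr R (bool * seq 'I_d) :=
  foldr (fun i => ediff (@jet_shift R d i)) (div_flux_expr P) w.

Lemma eeval_sum (R : realType) V (I : Type) (r : seq I) (E : I -> expr R V) u :
  eeval (\big[@Add R _/Cst 0]_(i <- r) E i) u = \sum_(i <- r) eeval (E i) u.
Proof. by elim: r => [|i r IH]; rewrite ?big_nil// !big_cons /= IH. Qed.

Lemma edom_sum (R : realType) V (I : Type) (r : seq I) (E : I -> expr R V) u :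
  (forall i, edom (E i) u) -> edom (\big[@Add R _/Cst 0]_(i <- r) E i) u.
Proof. by move=> dE; elim: r => [|i r IH]; rewrite ?big_nil// big_cons. Qed.

Lemma evars_sum (R : realType) V (Q : V -> Prop) (I : Type) (r : seq I)
    (E : I -> expr R V) :
  (forall i, evars Q (E i)) -> evars Q (\big[@Add R _/Cst 0]_(i <- r) E i).
Proof. by move=> dE; elim: r => [|i r IH]; rewrite ?big_nil// big_cons. Qed.

Lemma evars_esubst (R : realType) V V' (Q : V -> Prop) (Q' : V' -> Prop)
    (sg : V -> expr R V') E :
  (forall v, Q v -> evars Q' (sg v)) -> evars Q E -> evars Q' (esubst sg E).
Proof.
by move=> QQ; elim: E => //= E1 ? E2 ? []; intuition.
Qed.

Lemma evars_flux (R : realType) d (P : swe_data R d) i :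
  evars (fun v => (size v.2 <= 1)%N) (flux_expr P i).
Proof. by do !split => //; apply: evars_sum. Qed.

(** The flux is of first order, the divergence adds one derivative, and each letter of [w] one
    more. *)
Lemma evars_jet_rhs (R : realType) d (P : swe_data R d) w :
  evars (fun v => (size v.2 <= size w + 2)%N) (jet_rhs P w).
Proof.
elim: w => [|i w IH] /=.
  apply: evars_sum => i; apply: evars_ediff (evars_flux P i) => -[c w] /=; lia.
by apply: evars_ediff IH => -[c w'] /=; lia.
Qed.

(** Differentiation introduces no new base of a power, so the domain does not shrink. *)
Lemma edom_jet_rhs (R : realType) d (P : swe_data R d) w u :
  (forall i, edom (flux_expr P i) u) -> edom (jet_rhs P w) u.
Proof.
move=> df; elim: w => [|i w IH] /=; last exact: edom_ediff.
by apply: edom_sum => i; exact: edom_ediff.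
Qed.

Lemma enorm_ge0 (R : realType) d (v : 'rV[R]_d) : 0 <= enorm v.
Proof. exact: sqrtr_ge0. Qed.

Lemma grad_surface (R : realType) d (P : swe_data R d) (h : 'rV[R]_d -> R) x i :
  differentiable h x -> differentiable (bot P) x ->
  grad (surface P h) x 0 i = eeval (surface_expr R i) (jet_env h (bot P) x).
Proof.
by move=> dh db; rewrite mxE /surface deriveD//; exact: diff_derivable.
Qed.

Lemma slope_eval (R : realType) d (P : swe_data R d) (h : 'rV[R]_d -> R) x :
  differentiable h x -> differentiable (bot P) x ->
  eeval (slope_expr R d) (jet_env h (bot P) x) =
    \sum_(i < d) grad (surface P h) x 0 i ^+ 2.
Proof.
move=> dh db; rewrite eeval_sum; apply: eq_bigr => i _.
by rewrite grad_surface// expr2.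
Qed.

(** Where the gradient vanishes both sides are 0, because the power -1 of 0 and the inverse of 0
    both take the value 0. *)
Lemma flux_eval (R : realType) d (P : swe_data R d) (h : 'rV[R]_d -> R) x i :
  differentiable h x -> differentiable (bot P) x ->
  flux P h x 0 i = eeval (flux_expr P i) (jet_env h (bot P) x).
Proof.
move=> dh db; rewrite /flux [LHS]mxE [X in _ * X]mxE grad_surface//.
have sq : 0 <= eeval (slope_expr R d) (jet_env h (bot P) x).
  by rewrite slope_eval// sumr_ge0// => j _; exact: sqr_ge0.
rewrite /flux_expr /= powR12_sqrt; last first.
  by rewrite mulr_ge0 ?powR_ge0// invr_ge0 sqr_ge0.
rewrite powR_inv1 ?powR_ge0// [X in _ = _ * (X^-1 * _)]powR12_sqrt ?powR_ge0//.
by rewrite [in RHS]powR12_sqrt// slope_eval.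
Qed.

Lemma edom_flux (R : realType) d (P : swe_data R d) (h : 'rV[R]_d -> R) x i :
  0 < mann P -> 0 < h x -> differentiable h x -> differentiable (bot P) x ->
  grad (surface P h) x != 0 ->
  edom (flux_expr P i) (jet_env h (bot P) x).
Proof.
move=> k0 h0 dh db /rV0Pn[j gj].
have sq : 0 < eeval (slope_expr R d) (jet_env h (bot P) x).
  rewrite slope_eval// (bigD1 j)//= ltr_pwDl ?sumr_ge0//.
    by rewrite exprn_even_gt0.
  by move=> l _; exact: sqr_ge0.
do !split => //=; rewrite ?powR_gt0//.
  by rewrite mulr_gt0 ?powR_gt0// invr_gt0 exprn_gt0.
by apply: edom_sum => l.
Qed.

Lemma jet_env_differentiable (R : realType) d (D : set 'rV[R]_d)
    (h b : 'rV[R]_d -> R) x v :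
  smooth_on D h -> smooth_on D b -> D x ->
  differentiable (fun y => jet_env h b y v) x.
Proof. by case: v => -[] w sh sb Dx; [apply: sb|apply: sh]. Qed.

(** Stated through [edom], so that openness in space and persistence for small times follow from
    continuity of the jets. *)
Definition flux_domain (R : realType) d (P : swe_data R d)
    (D : set 'rV[R]_d) (h : 'rV[R]_d -> R) : set 'rV[R]_d :=
  [set x | D x /\ forall i, edom (flux_expr P i) (jet_env h (bot P) x)].

Lemma open_flux_domain (R : realType) d (P : swe_data R d)
    (D : set 'rV[R]_d) (h : 'rV[R]_d -> R) :
  open D -> smooth_on D h -> smooth_on D (bot P) -> open (flux_domain P D h).
Proof.
move=> oD sh sb; rewrite openE => x [Dx dx].
have n1 : \forall y \near x, D y by exact: open_nbhs_nbhs.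
have n2 : \forall y \near x, forall i, edom (flux_expr P i) (jet_env h (bot P) y).
  apply: (@filter_forall _ _ (fun i y => edom (flux_expr P i) (jet_env h (bot P) y)) (nbhs x)) => i.
  apply: (@near_edom _ _ (nbhs x) _ _ _ (jet_env h (bot P)) _ _ (dx i)) => v.
  exact: (differentiable_continuous (jet_env_differentiable v sh sb Dx)).
exact: filterI n1 n2.
Qed.

Lemma div_flux_eval (R : realType) d (P : swe_data R d)
    (D : set 'rV[R]_d) (h : 'rV[R]_d -> R) x :
  open D -> smooth_on D h -> smooth_on D (bot P) -> flux_domain P D h x ->
  div (flux P h) x = eeval (div_flux_expr P) (jet_env h (bot P) x).
Proof.
move=> oD sh sb [Dx dx]; rewrite eeval_sum; apply: eq_bigr => i _.
have <- : 'D_(delta_mx 0 i) (fun y => eeval (flux_expr P i) (jet_env h (bot P) y)) x =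
    eeval (ediff (@jet_shift R d i) (flux_expr P i)) (jet_env h (bot P) x).
  by apply: eval_derive => // v; exact: (jet_env_differentiable v sh sb Dx).
apply: near_eq_derive; near=> y.
have Dy : D y by near: y; exact: open_nbhs_nbhs.
by apply: flux_eval; [exact: (sh [::])|exact: (sb [::])].
Unshelve. all: by end_near. Qed.

Lemma jet_rhs_differentiable (R : realType) d (P : swe_data R d)
    (D : set 'rV[R]_d) (h : 'rV[R]_d -> R) w x :
  smooth_on D h -> smooth_on D (bot P) -> flux_domain P D h x ->
  differentiable (fun y => eeval (jet_rhs P w) (jet_env h (bot P) y)) x.
Proof.
move=> sh sb [Dx dx]; apply: eval_differentiable; last exact: edom_jet_rhs.
by move=> v; exact: (jet_env_differentiable v sh sb Dx).
Qed.

Lemma jet_rhs_derive (R : realType) d (P : swe_data R d)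
    (D : set 'rV[R]_d) (h : 'rV[R]_d -> R) w x i :
  smooth_on D h -> smooth_on D (bot P) -> flux_domain P D h x ->
  'D_(delta_mx 0 i) (fun y => eeval (jet_rhs P w) (jet_env h (bot P) y)) x =
  eeval (jet_rhs P (i :: w)) (jet_env h (bot P) x).
Proof.
move=> sh sb [Dx dx]; apply: eval_derive => //; last exact: edom_jet_rhs.
by move=> v; exact: (jet_env_differentiable v sh sb Dx).
Qed.

Lemma jet_div_flux (R : realType) d (P : swe_data R d)
    (D : set 'rV[R]_d) (h : 'rV[R]_d -> R) w x :
  open D -> smooth_on D h -> smooth_on D (bot P) -> flux_domain P D h x ->
  jet (div (flux P h)) w x = eeval (jet_rhs P w) (jet_env h (bot P) x).
Proof.
move=> oD sh sb; elim: w x => [|i w IH] x Gx; first exact: (div_flux_eval oD sh sb).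
rewrite -(jet_rhs_derive w i sh sb Gx); apply: near_eq_derive.
near=> y; apply: IH; near: y; apply: open_nbhs_nbhs.
by split => //; exact: (open_flux_domain oD sh sb).
Unshelve. all: by end_near. Qed.

(** The stage equation holds on the open set [D] and [flux_domain] is open, so it can be
    differentiated repeatedly: the jets of a stage satisfy the stage equation of the jet system. *)
Lemma jet_stage (R : realType) d s (P : swe_data R d) (D : set 'rV[R]_d)
    (f h0 : 'rV[R]_d -> R) (h : 'I_s -> 'rV[R]_d -> R) (c : 'I_s -> R) w x :
  open D -> smooth_on D (bot P) -> smooth_on D h0 ->
  (forall j, smooth_on D (h j)) -> D x -> (forall j, flux_domain P D (h j) x) ->
  (forall y, D y -> f y = h0 y + \sum_(j < s) c j * div (flux P (h j)) y) ->
  jet f w x = jet h0 w x + \sum_(j < s) c j * eeval (jet_rhs P w) (jet_env (h j) (bot P) x).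
Proof.
move=> oD sb sh0 sh + + fE; elim: w x => [|i w IH] x Dx Gx.
  rewrite [LHS]fE//; congr (_ + _); apply: eq_bigr => j _.
  by rewrite (div_flux_eval oD (sh j)).
pose e j (y : 'rV[R]_d) := c j * eeval (jet_rhs P w) (jet_env (h j) (bot P) y).
have de j : differentiable (e j) x.
  by apply: differentiableM => //; exact: jet_rhs_differentiable (Gx j).
transitivity ('D_(delta_mx 0 i) (jet h0 w + \sum_(j < s) e j) x).
  apply: near_eq_derive; near=> y; rewrite !fctE fct_sumE; apply: IH.
    by near: y; exact: open_nbhs_nbhs.
  near: y.
  apply: (@filter_forall _ _ (fun j y => flux_domain P D (h j) y) (nbhs x)) => j.
  by apply: open_nbhs_nbhs; split => //; exact: open_flux_domain.
have dse : derivable (\sum_(j < s) e j) x (delta_mx 0 i).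
  by apply: diff_derivable; exact: differentiable_sum.
rewrite deriveD//; last by apply: diff_derivable; exact: sh0.
rewrite derive_sum => [|j]; last exact: diff_derivable.
congr (_ + _); apply: eq_bigr => j _; rewrite /e.
rewrite -(jet_rhs_derive w i (sh j) sb (Gx j)).
apply: (deriveZ (c j)).
by apply: diff_derivable; exact: jet_rhs_differentiable (Gx j).
Unshelve. all: by end_near. Qed.

(** * Order of the limiting scheme *)

Definition time_slab (R : realType) d (T : R) (D : set 'rV[R]_d) :
    set (R * 'rV[R]_d) :=
  [set z | 0 < z.1 < T /\ D z.2].

Lemma open_time_slab (R : realType) d (T : R) (D : set 'rV[R]_d) :
  open D -> open (time_slab T D).
Proof.
move=> oD.
have -> : time_slab T D = (fst @^-1` `]0, T[) `&` (snd @^-1` D).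
  by apply/seteqP; split => z /=; rewrite in_itv/=.
apply: openI; apply: open_comp => // z _; [exact: cvg_fst|exact: cvg_snd].
Qed.

Lemma smooth_on_slice (R : realType) d (T : R) (D : set 'rV[R]_d)
    (h : R -> 'rV[R]_d -> R) t :
  smooth_on (time_slab T D) (fun z => h z.1 z.2) -> 0 < t < T ->
  smooth_on D (h t).
Proof.
move=> sh tT vs x Dx.
have -> : iter_deriv vs (h t) =
    iter_deriv [seq (0, v) | v <- vs] (fun z : R * 'rV[R]_d => h z.1 z.2) \o
      (fun y => (t, y)).
  by apply/funext => y; rewrite (iter_deriv_slice (fun z => h z.1 z.2)).
by apply: differentiable_comp; [exact: differentiable_pair|exact: sh].
Qed.

(** Jets are derivatives on space-time in directions [(0, v)]; they commute with the direction
    [(1, 0)], after which the limiting equation replaces the time derivative by the divergence of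
    the flux. *)
Lemma jet_time_derive (R : realType) d (P : swe_data R d) (T : R)
    (D : set 'rV[R]_d) (h : R -> 'rV[R]_d -> R) w x t :
  open D -> smooth_on D (bot P) ->
  smooth_on (time_slab T D) (fun z => h z.1 z.2) ->
  (forall t x, 0 < t < T -> D x ->
     is_derive t (1 : R) (fun r => h r x) (div (flux P (h t)) x)) ->
  0 < t < T -> flux_domain P D (h t) x ->
  is_derive t (1 : R) (fun r => jet (h r) w x)
    (eeval (jet_rhs P w) (jet_env (h t) (bot P) x)).
Proof.
move=> oD sb sF Dh tT Gx; have [Dx _] := Gx.
pose F (z : R * 'rV[R]_d) := h z.1 z.2.
pose vs := [seq (0 : R, v) | v <- [seq (delta_mx 0 i : 'rV[R]_d) | i <- w]].
have oO := @open_time_slab R d T D oD.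
have jetE r y : jet (h r) w y = iter_deriv vs F (r, y) by exact: (iter_deriv_slice F).
have AE y (s r : R) : (s *: (1 : R) + r, y) = s *: (1, 0) + (r, y) :> R * 'rV[R]_d.
  by apply/pair_equal_spec; rewrite /= scaler0 add0r.
have -> : (fun r => jet (h r) w x) = iter_deriv vs F \o (fun r => (r, x)).
  by apply/funext => r; rewrite jetE.
apply: DeriveDef.
  apply: (derivable_affine (w := (1, 0) : R * 'rV[R]_d)); first by move=> s; exact: AE.
  by apply: diff_derivable; exact: sF.
rewrite (derive_affine _ (w := (1, 0) : R * 'rV[R]_d)); last by move=> s; exact: AE.
rewrite (iter_deriv_comm _ _ oO sF)// -(iter_deriv_slice ('D_(1, 0) F)).
rewrite -(jet_div_flux w oD (smooth_on_slice sF tT) sb Gx).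
apply: (eq_iter_deriv _ oD) => // y /[!inE] Dy.
have [_ <-] := Dh t y tT Dy; rewrite -[RHS]/('D_1 (F \o (fun r => (r, y))) t).
by rewrite (derive_affine _ (w := (1, 0) : R * 'rV[R]_d)) => // s; exact: AE.
Qed.

(** The bottom does not depend on time, so at fixed [x] its jets are constants and only the depth
    jets remain unknown. *)
Definition at_bottom (R : realType) d (b : 'rV[R]_d -> R) (x : 'rV[R]_d)
    (v : bool * seq 'I_d) : expr R (seq 'I_d) :=
  if v.1 then Cst (jet b v.2 x) else Var v.2.

Lemma eeval_at_bottom (R : realType) d (b h : 'rV[R]_d -> R) x E :
  eeval (esubst (at_bottom b x) E) (fun w => jet h w x) = eeval E (jet_env h b x).
Proof. by rewrite eval_esubst; congr eeval; apply/funext => -[[] w]. Qed.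

Lemma edom_at_bottom (R : realType) d (b h : 'rV[R]_d -> R) x E :
  edom E (jet_env h b x) -> edom (esubst (at_bottom b x) E) (fun w => jet h w x).
Proof.
move=> dE; apply: edom_esubst => [[[] w]//|].
by rewrite [X in edom _ X](_ : _ = jet_env h b x)//; apply/funext => -[[] w].
Qed.

Lemma near_flux_domain (R : realType) d (P : swe_data R d) (D : set 'rV[R]_d)
    (h0 : 'rV[R]_d -> R) (h : R -> 'rV[R]_d -> R) x :
  smooth_cvg_on D h h0 -> flux_domain P D h0 x ->
  \forall t \near (0 : R)^'+, flux_domain P D (h t) x.
Proof.
move=> ch [Dx dx].
have : \forall t \near (0 : R)^'+, forall i, edom (flux_expr P i) (jet_env (h t) (bot P) x).
  apply: (@filter_forall _ _ (fun i t => edom (flux_expr P i) (jet_env (h t) (bot P) x)) (0^'+)) => i.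
  apply: (@near_edom _ _ (0^'+) _ _ _ (fun t => jet_env (h t) (bot P) x) _ _ (dx i)).
  by case=> -[] w; rewrite /jet_env /=; [exact: cvg_cst|exact: ch].
by apply: filterS => t.
Qed.

Lemma flux_domain_init (R : realType) d (P : swe_data R d)
    (D : set 'rV[R]_d) (h : 'rV[R]_d -> R) x :
  0 < mann P -> smooth_on D (bot P) -> smooth_on D h -> 0 < h x ->
  grad (surface P h) x != 0 -> D x -> flux_domain P D h x.
Proof.
move=> k0 sb sh h0 g0 Dx; split=> // i; apply: edom_flux => //.
  exact: (sh [::]).
exact: (sb [::]).
Qed.

(** At the fixed point [x] the depth jets of the exact solution and of the stages obey one jet
    system, to which [jets_order] applies. *)
Lemma limit_scheme_order (R : realType) d (P : swe_data R d) (D : set 'rV[R]_d)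
    s (M : imex_tableau R s) p (T : R) (h0 : 'rV[R]_d -> R)
    (hS : R -> 'I_s -> 'rV[R]_d -> R) (hexa : R -> 'rV[R]_d -> R) x w (i : 'I_s) :
  imex_order M p -> diagonally_implicit M -> im_wt M = row i (im_mx M) ->
  open D -> smooth_on D (bot P) -> smooth_on D h0 -> flux_domain P D h0 x ->
  (forall i, \forall dt \near (0 : R)^'+, smooth_on D (hS dt i)) ->
  (forall i, smooth_cvg_on D (fun dt => hS dt i) h0) ->
  (\forall dt \near (0 : R)^'+, forall i y, D y ->
     hS dt i y = h0 y + dt * \sum_(j < s | (j <= i)%N) im_mx M i j * div (flux P (hS dt j)) y) ->
  0 < T -> smooth_on (time_slab T D) (fun z => hexa z.1 z.2) ->
  (forall t x, 0 < t < T -> D x ->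
     is_derive t (1 : R) (fun r => hexa r x) (div (flux P (hexa t)) x)) ->
  smooth_cvg_on D hexa h0 ->
  bigO_pow p.+1 (fun dt => jet (hS dt i) w x - jet (hexa dt) w x).
Proof.
move=> oM [dM _] wM oD sb sh0 Gx shS chS HS T0 sF Dh che; have [Dx dx] := Gx.
pose E w := esubst (at_bottom (bot P) x) (jet_rhs P w).
have HE i' w' : \forall dt \near (0 : R)^'+,
    jet (hS dt i') w' x = jet h0 w' x + dt * \sum_(j < s | (j <= i')%N)
      im_mx M i' j * eeval (E w') (fun w => jet (hS dt j) w x).
  have n1 : \forall dt \near (0 : R)^'+, forall j, smooth_on D (hS dt j).
    exact: (@filter_forall _ _ (fun j dt => smooth_on D (hS dt j)) (0^'+)).
  have n2 : \forall dt \near (0 : R)^'+, forall j, flux_domain P D (hS dt j) x.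
    apply: (@filter_forall _ _ (fun j dt => flux_domain P D (hS dt j) x) (0^'+)) => j.
    exact: near_flux_domain (chS j) Gx.
  near=> dt.
  have sdt : forall j, smooth_on D (hS dt j) by near: dt.
  have gdt : forall j, flux_domain P D (hS dt j) x by near: dt.
  have edt : forall i y, D y -> hS dt i y = h0 y +
    dt * \sum_(j < s | (j <= i)%N) im_mx M i j * div (flux P (hS dt j)) y by near: dt.
  (* [jet_stage] takes full sums, so the coefficients beyond the diagonal are set to 0. *)
  rewrite (jet_stage (c := fun j => dt * (if (j <= i')%N then im_mx M i' j else 0))
    (h0 := h0) (h := hS dt) w' oD sb sh0 sdt Dx gdt).
    congr (_ + _); rewrite mulr_sumr [RHS]big_mkcond; apply: eq_bigr => j _ /=.
    by rewrite eeval_at_bottom mulrA; case: ifP => // _; rewrite mulr0 mul0r.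
  move=> y Dy; rewrite edt//; congr (_ + _).
  rewrite mulr_sumr [LHS]big_mkcond; apply: eq_bigr => j _ /=.
  by rewrite mulrA; case: ifP => // _; rewrite mulr0 mul0r.
have := @jets_order R 'I_d s M p E (fun w => jet h0 w x) (fun t w => jet (hexa t) w x)
  (fun dt i w => jet (hS dt i) w x) w oM.
move=> H; apply: eq_near_bigO (H _ _ _ _ _ _) => {H} //.
(* The weights being row [i] of a lower triangular matrix, the update coincides with stage [i]. *)
- apply: filterS (HE i w) => dt ->; rewrite wM; congr (_ + _ * _ - _).
  rewrite [RHS]big_mkcond; apply: eq_bigr => j _; rewrite !mxE.
  by case: ifPn => //; rewrite -ltnNge => /dM ->; rewrite mul0r.
- move=> w'; apply: evars_esubst (evars_jet_rhs P w') => -[[] w''] //.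
- move=> w'; apply: edom_at_bottom; exact: edom_jet_rhs.
- by move=> w'; exact: che.
- move=> w'; have n1 := near_flux_domain che Gx; near=> t.
  rewrite eeval_at_bottom; apply: (jet_time_derive _ oD sb sF Dh).
    by apply/andP; split => //; near: t; exact: nbhs_right_lt.
  by near: t.
- by move=> j w'; exact: chS.
Unshelve. all: by end_near. Qed.

(** * Balance of pressure, bottom and friction *)

Lemma enormZ (R : realType) d (a : R) (v : 'rV[R]_d) :
  enorm (a *: v) = `|a| * enorm v.
Proof.
rewrite /enorm; under eq_bigr do rewrite mxE exprMn.
by rewrite -mulr_sumr sqrtrM ?sqr_ge0// sqrtr_sqr.
Qed.

Lemma enormN (R : realType) d (v : 'rV[R]_d) : enorm (- v) = enorm v.
Proof. by rewrite -scaleN1r enormZ normrN1 mul1r. Qed.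

Lemma enorm0_eq0 (R : realType) d (v : 'rV[R]_d) : enorm v = 0 -> v = 0.
Proof.
move=> /eqP; rewrite sqrtr_eq0 => v0; apply/rowP => i; rewrite mxE; apply/eqP.
have s0 : 0 <= \sum_(i < d) v 0 i ^+ 2 by rewrite sumr_ge0// => j _; exact: sqr_ge0.
have /eqP : \sum_(i < d) v 0 i ^+ 2 = 0 by apply/eqP; rewrite eq_le v0 s0.
rewrite psumr_eq0 => [/allP/(_ i)|j _]; last exact: sqr_ge0.
by rewrite mem_index_enum sqrf_eq0 => /(_ isT).
Qed.

(** Taking norms shows that the squares of the two norms agree; the common norm can then be
    cancelled unless it is 0. *)
Lemma enorm_scale_inj (R : realType) d (v w : 'rV[R]_d) :
  enorm v *: v = enorm w *: w -> v = w.
Proof.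
move=> vw; have nvw : enorm v = enorm w.
  have : enorm (enorm v *: v) = enorm (enorm w *: w) by rewrite vw.
  rewrite !enormZ !ger0_norm ?enorm_ge0// -!expr2 => /eqP.
  by rewrite eqrXn2 ?enorm_ge0// => /eqP.
have [w0|w0] := eqVneq (enorm w) 0.
  by rewrite (enorm0_eq0 w0) (enorm0_eq0 (etrans nvw w0)).
by apply: (scalerI w0); rewrite -vw nvw.
Qed.

(** The stiff part of the momentum equation, that is, the terms carrying the factor 1/e^2, up to
    sign. *)
Definition balance (R : realType) d (P : swe_data R d) (U : state R d)
    (x : 'rV[R]_d) : 'rV[R]_d :=
  pressure P U x + bottom_source P U x + friction P U x.

(** The flux inverts the quadratic friction law, which is why the momentum balance can be solved for
    it. *)
Lemma flux_norm (R : realType) d (P : swe_data R d) (h : 'rV[R]_d -> R) x :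
  0 < mann P ->
  enorm (flux P h x) *: flux P h x =
  (h x `^ (eta P + 1) / mann P ^+ 2) *: grad (surface P h) x.
Proof.
move=> k0; rewrite /flux; set A := _ / _; set G := grad _ _.
have A0 : 0 <= A by rewrite mulr_ge0 ?powR_ge0// invr_ge0 sqr_ge0.
rewrite !enormZ ger0_norm ?sqrtr_ge0// ger0_norm ?invr_ge0 ?sqrtr_ge0//.
have [G0|G0] := eqVneq (enorm G) 0.
  by rewrite (enorm0_eq0 G0) !scaler0.
have S0 : Num.sqrt (enorm G) != 0.
  by rewrite sqrtr_eq0 -ltNge lt_def G0 enorm_ge0.
rewrite !scalerA; congr (_ *: _).
move: (sqr_sqrtr A0) (sqr_sqrtr (enorm_ge0 G)) S0.
by move: (Num.sqrt A) (Num.sqrt (enorm G)) => a b <- <- b0; field.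
Qed.

Lemma balance_flux (R : realType) d (P : swe_data R d) (U : state R d) x :
  0 < grav P -> 0 < mann P -> 0 < depth U x ->
  differentiable (depth U) x -> differentiable (bot P) x ->
  balance P U x = 0 <-> momentum U x = - flux P (depth U) x.
Proof.
move=> g0 k0 h0 dh db.
set q := momentum U x; set h := depth U x in h0 *.
have prE : pressure P U x = (grav P * h) *: grad (depth U) x.
  apply/rowP => i; rewrite !mxE.
  have dd : derivable (depth U) x (delta_mx 0 i) by exact: diff_derivable.
  rewrite (_ : (fun y => _) = grav P / 2 *: (depth U ^+ 2)); last first.
    by apply/funext => y; rewrite !fctE.
  rewrite deriveZ; last exact: derivableX.
  by rewrite deriveX// -/h expr1 /GRing.scale/=; field.
have gE : grad (surface P (depth U)) x = grad (depth U) x + grad (bot P) x.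
  by apply/rowP => i; rewrite !mxE /surface deriveD//; exact: diff_derivable.
pose A := h `^ (eta P + 1) / mann P ^+ 2.
have A0 : 0 < A by rewrite divr_gt0 ?powR_gt0// exprn_gt0.
(* After this factorisation, with a positive factor, the balance is the equation
   [|q| q = - A grad H], which determines [q] by injectivity of [|q| q]. *)
have bE : balance P U x = (grav P * h / A) *:
    (A *: grad (surface P (depth U)) x + enorm q *: q).
  rewrite /balance prE gE /bottom_source /friction -/h -/q !scalerDr !scalerA.
  rewrite divfK ?gt_eqF//; congr (_ + _ + _ *: _).
  rewrite /A powRD; last by apply/implyP => _; rewrite gt_eqF.
  rewrite powRr1 ?ltW//; field.
  by rewrite !gt_eqF// powR_gt0.
have c0 : grav P * h / A != 0 by rewrite gt_eqF// divr_gt0// mulr_gt0.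
split.
  move=> /eqP; rewrite bE scaler_eq0 (negPf c0)/= addrC addr_eq0 => /eqP qE.
  by apply: enorm_scale_inj; rewrite enormN scalerN flux_norm.
move=> qE; rewrite bE.
have -> : enorm q *: q = - (A *: grad (surface P (depth U)) x).
  by rewrite qE enormN scalerN flux_norm.
by rewrite subrr scaler0.
Qed.

Lemma bigO_cvg (R : realType) (W : normedModType R) n (u : R -> W) (l : W) :
  bigO_pow n.+1 (fun t => u t - l) -> u t @[t --> 0^'+] --> l.
Proof.
move=> /bigO_cvg0 ul.
have : (fun t => (u t - l) + l) t @[t --> 0^'+] --> 0 + l.
  by apply: cvgD => //; exact: cvg_cst.
by rewrite add0r; under eq_fun do rewrite subrK.
Qed.

Lemma mu_cvg (R : realType) d (P : swe_data R d) : mu P e @[e --> 0^'+] --> (1 : R).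
Proof.
apply: cvg_at_right_filter.
have c1 : (fun e : R => - (e ^+ 2) / dx P) e @[e --> (0 : R)] --> - (0 ^+ 2) / dx P.
  by apply: cvgM; [apply: cvgN; exact: exprn_continuous|exact: cvg_cst].
have := cvg_comp _ expR c1 (@continuous_expR R _).
by rewrite expr0n oppr0 mul0r expR0.
Qed.

(** * The limit of the scheme *)

Lemma fst_sum (V W : zmodType) I (r : seq I) (Q : pred I) (F : I -> V * W) :
  (\sum_(i <- r | Q i) F i).1 = \sum_(i <- r | Q i) (F i).1.
Proof. exact: (big_morph fst). Qed.

Lemma snd_sum (V W : zmodType) I (r : seq I) (Q : pred I) (F : I -> V * W) :
  (\sum_(i <- r | Q i) F i).2 = \sum_(i <- r | Q i) (F i).2.
Proof. exact: (big_morph snd). Qed.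

Lemma chapman_enskog_cvg (R : realType) d (P : swe_data R d) (D : set 'rV[R]_d)
    (U : R -> state R d) (U0 : state R d) x :
  chapman_enskog P D U U0 -> D x -> U e x @[e --> 0^'+] --> U0 x.
Proof. by move=> [_ _ H] Dx; have [+ _] := H x Dx; exact: bigO_cvg. Qed.

Lemma cvg_depth (R : realType) d (U : R -> state R d) (U0 : state R d) x :
  U e x @[e --> 0^'+] --> U0 x -> depth (U e) x @[e --> 0^'+] --> depth U0 x.
Proof. by move=> cU; apply: cvg_comp cU _; exact: cvg_fst. Qed.

Lemma cvg_momentum (R : realType) d (U : R -> state R d) (U0 : state R d) x :
  U e x @[e --> 0^'+] --> U0 x -> momentum (U e) x @[e --> 0^'+] --> momentum U0 x.
Proof. by move=> cU; apply: cvg_comp cU _; exact: cvg_snd. Qed.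

Lemma cvg_lincomb (R : realType) (W : normedModType R) T (F : set_system T)
    {FF : Filter F} (I : finType) (Q : pred I) (c : I -> R) (f : I -> T -> W)
    (l : I -> W) :
  (forall i, f i t @[t --> F] --> l i) ->
  \sum_(i | Q i) c i *: f i t @[t --> F] --> \sum_(i | Q i) c i *: l i.
Proof.
move=> fl; apply: cvg_big => [|i _]; first exact: add_continuous.
by apply: cvgZl_tmp; exact: fl.
Qed.

Lemma div_eq_opp (R : realType) d (D : set 'rV[R]_d) (v w : 'rV[R]_d -> 'rV[R]_d) x :
  open D -> (forall y, D y -> v y = - w y) -> differentiable w x -> D x ->
  div v x = - div w x.
Proof.
move=> oD vw dw Dx; rewrite /div -sumrN; apply: eq_bigr => i _.
have dwi : derivable (fun y => w y 0 i) x (delta_mx 0 i).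
  have : derivable w x (delta_mx 0 i) by exact: diff_derivable.
  by move/derivable_mxP; exact.
rewrite -(deriveN dwi); apply: near_eq_derive; near=> y.
by rewrite vw ?mxE//; near: y; exact: open_nbhs_nbhs.
Unshelve. all: by end_near. Qed.

(** The momentum stage equation is multiplied by [e ^ 2]: momenta and convection stay bounded and
    drop out, and only the implicit stiff terms survive. *)
Lemma balance_stages (R : realType) d (P : swe_data R d)
    (D : set 'rV[R]_d) s (M : imex_tableau R s) (dt : R)
    (Un : R -> state R d) (Un0 : state R d)
    (US : R -> 'I_s -> state R d) (US0 : 'I_s -> state R d)
    (U1 : R -> state R d) (i : 'I_s) x :
  0 < dt -> D x -> bigO_pow 1 (fun e => Un e x - Un0 x) ->
  (\forall e \near (0 : R)^'+, forall x, D x ->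
     imex_step M dt (Un e x) (fun i => US e i x)
       (fun i => swe_F P e (US e i) x) (fun i => swe_G P e (US e i) x)
       (U1 e x)) ->
  (forall i, chapman_enskog P D (fun e => US e i) (US0 i)) ->
  \sum_(j < s | (j <= i)%N) im_mx M i j *: balance P (US0 j) x = 0.
Proof.
move=> dt0 Dx /bigO_cvg/cvg_momentum cn HS CE.
have cb j : balance P (US e j) x @[e --> 0^'+] --> balance P (US0 j) x.
  have [_ _ /(_ x Dx)[_ [_ _ _ [c1 c2 c3]]]] := CE j.
  by apply: cvgD => //; exact: cvgD.
have cc j : - convection (US e j) x @[e --> 0^'+] --> - convection (US0 j) x.
  by have [_ _ /(_ x Dx)[_ [_ _ c _]]] := CE j; exact: cvgN.
have cq := cvg_momentum (chapman_enskog_cvg (CE i) Dx).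
pose B e := \sum_(j < s | (j <= i)%N) im_mx M i j *: balance P (US e j) x.
have cB : B e @[e --> 0^'+] --> \sum_(j < s | (j <= i)%N) im_mx M i j *: balance P (US0 j) x.
  exact: cvg_lincomb.
pose S e := \sum_(j < s | (j < i)%N) ex_mx M i j *: - convection (US e j) x.
have BE : \forall e \near (0 : R)^'+,
    (- dt^-1 * e ^+ 2) *: (momentum (US e i) x - momentum (Un e) x - dt *: S e) = B e.
  apply: filterS2 (nbhs_right_gt (0 : R)) HS => e e0 /(_ x Dx)[/(_ i) E _].
  have := congr1 snd E; rewrite /= !snd_sum => E2.
  rewrite {1}/momentum E2 /S /momentum.
  have -> : \sum_(j < s | (j < i)%N) (ex_mx M i j *: swe_F P e (US e j) x).2 =
    \sum_(j < s | (j < i)%N) ex_mx M i j *: - convection (US e j) x by [].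
  have gen (a b c : 'rV[R]_d) : a + b + c - a - b = c.
    by rewrite -addrA -opprD [a + b + c]addrC addrK.
  rewrite gen.
  rewrite scalerA scaler_sumr /B; apply: eq_bigr => j _.
  rewrite -[(_ *: _).2]/(im_mx M i j *: (swe_G P e (US e j) x).2).
  have -> : (swe_G P e (US e j) x).2 = - (e ^+ 2)^-1 *: balance P (US e j) x.
    by rewrite /swe_G /balance /= !scalerDr !scaleNr.
  by rewrite !scalerA; congr (_ *: _); field; rewrite !gt_eqF.
have c2 : (- dt^-1 * e ^+ 2) *: (momentum (US e i) x - momentum (Un e) x - dt *: S e)
    @[e --> (0 : R)^'+] --> (0 : R) *: (momentum (US0 i) x - momentum Un0 x -
      dt *: \sum_(j < s | (j < i)%N) ex_mx M i j *: - convection (US0 j) x).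
  apply: cvgZ.
    rewrite -[X in _ --> X](mulr0 (- dt^-1)); apply: cvgM; first exact: cvg_cst.
    by have := bigO_cvg0 (@bigOM R 1 1 _ _ (bigO_id R) (bigO_id R)).
  apply: cvgB; first exact: cvgB.
  by apply: cvgZl_tmp; exact: cvg_lincomb.
rewrite scale0r in c2.
have c3 : B e @[e --> 0^'+] --> (0 : 'rV[R]_d).
  exact: (cvg_trans (near_eq_cvg BE) c2).
exact: (norm_cvg_unique cB c3).
Unshelve. all: by end_near. Qed.

(** Strong induction on the stage: once the earlier balances vanish, [balance_stages] reduces to the
    diagonal term, so either the balance or the diagonal coefficient is 0. *)
Lemma limit_momentum (R : realType) d (P : swe_data R d)
    (D : set 'rV[R]_d) s (M : imex_tableau R s) (dt : R)
    (Un : R -> state R d) (Un0 : state R d)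
    (US : R -> 'I_s -> state R d) (US0 : 'I_s -> state R d)
    (U1 : R -> state R d) (i : 'I_s) x :
  0 < grav P -> 0 < mann P -> open D -> smooth_on D (bot P) ->
  diagonally_implicit M -> 0 < dt -> D x -> well_prepared P D Un Un0 ->
  (\forall e \near (0 : R)^'+, forall x, D x ->
     imex_step M dt (Un e x) (fun i => US e i x)
       (fun i => swe_F P e (US e i) x) (fun i => swe_G P e (US e i) x)
       (U1 e x)) ->
  (forall i, chapman_enskog P D (fun e => US e i) (US0 i)) ->
  momentum (US0 i) x = - flux P (depth (US0 i)) x.
Proof.
move=> g0 k0 oD sb [_ dM] dt0 Dx wp HS CE.
have balP j : balance P (US0 j) x = 0 <-> momentum (US0 j) x = - flux P (depth (US0 j)) x.
  have [_ /(_ x Dx)[h0 dh _ _] _] := CE j.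
  by apply: balance_flux => //; exact: (sb [::]).
apply/balP; have [n] := ubnP (val i); elim: n i => // n IH i /ltnSE lein.
have := balance_stages i dt0 Dx (wp x Dx).1 HS CE.
rewrite (bigD1 i)//= big1 ?addr0 => [/eqP|j /andP[ji jni]]; last first.
  by rewrite IH ?scaler0//; apply: leq_trans lein; rewrite ltn_neqAle jni.
rewrite scaler_eq0 => /orP[/eqP m0|/eqP//].
have i0 : val i = 0%N.
  by have [//|/dM] := posnP (val i); rewrite m0 eqxx.
(* The first stage is explicit: it is the initial value, which is well-prepared. *)
have US0E y : D y -> US0 i y = Un0 y.
  move=> Dy; apply: (norm_cvg_unique (chapman_enskog_cvg (CE i) Dy)).
  have := bigO_cvg (wp y Dy).1; apply: cvg_trans; apply: near_eq_cvg.
  apply: filterS HS => e /(_ y Dy)[/(_ i) -> _].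
  rewrite big_pred0 ?scaler0 ?addr0 => [|j]; last by rewrite [nat_of_ord i]i0.
  rewrite big1 ?scaler0 ?addr0// => j; rewrite [nat_of_ord i]i0 leqn0 => /eqP j0.
  have -> : j = i by apply: val_inj; rewrite i0.
  by rewrite m0 scale0r.
have qE : momentum (US0 i) x = momentum Un0 x by rewrite /momentum US0E.
apply/balP; rewrite qE (wp x Dx).2.
congr (- _); rewrite /flux.
(* Equality on the open set [D], rather than at [x] alone, passes to the gradients. *)
have -> : grad (surface P (depth Un0)) x = grad (surface P (depth (US0 i))) x.
  apply/rowP => j; rewrite !mxE; apply: near_eq_derive; near=> y.
  by rewrite /surface /depth US0E//; near: y; exact: open_nbhs_nbhs.
by rewrite /depth US0E.
Unshelve. all: by end_near. Qed.

(** Since [mu] tends to 1 and the limiting momentum is minus the flux, the explicit mass terms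
    cancel in the limit; the implicit ones become the divergence of the flux. *)
Lemma limit_depth (R : realType) d (P : swe_data R d)
    (D : set 'rV[R]_d) s (M : imex_tableau R s) (dt : R)
    (Un : R -> state R d) (Un0 : state R d)
    (US : R -> 'I_s -> state R d) (US0 : 'I_s -> state R d)
    (U1 : R -> state R d) (i : 'I_s) x :
  open D -> (forall j x, D x -> momentum (US0 j) x = - flux P (depth (US0 j)) x) ->
  D x -> well_prepared P D Un Un0 ->
  (\forall e \near (0 : R)^'+, forall x, D x ->
     imex_step M dt (Un e x) (fun i => US e i x)
       (fun i => swe_F P e (US e i) x) (fun i => swe_G P e (US e i) x)
       (U1 e x)) ->
  (forall i, chapman_enskog P D (fun e => US e i) (US0 i)) ->
  depth (US0 i) x = depth Un0 x
    + dt * \sum_(j < s | (j <= i)%N) im_mx M i j * div (flux P (depth (US0 j))) x.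
Proof.
move=> oD qE Dx wp HS CE.
have cU := cvg_depth (chapman_enskog_cvg (CE i) Dx).
apply: (norm_cvg_unique cU).
have cm := mu_cvg P.
have cF j : mu P e * div (flux P (depth (US e j))) x @[e --> 0^'+] -->
    1 * div (flux P (depth (US0 j))) x.
  by have [_ _ /(_ x Dx)[_ [_ c _ _]]] := CE j; apply: cvgM.
have cq j : - div (momentum (US e j)) x - mu P e * div (flux P (depth (US e j))) x
    @[e --> 0^'+] --> (0 : R).
  have [_ /(_ x Dx)[_ _ _ df] /(_ x Dx)[_ [c _ _ _]]] := CE j.
  have e0 : - div (momentum (US0 j)) x - 1 * div (flux P (depth (US0 j))) x = 0.
    by rewrite (div_eq_opp oD (qE j) df Dx) opprK mul1r subrr.
  by rewrite -[X in _ --> X]e0; apply: cvgB (cF j); exact: cvgN.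
have cn := cvg_depth (bigO_cvg (wp x Dx).1).
pose S1 e := \sum_(j < s | (j < i)%N) ex_mx M i j *:
  (- div (momentum (US e j)) x - mu P e * div (flux P (depth (US e j))) x).
pose S2 e := \sum_(j < s | (j <= i)%N) im_mx M i j *:
  (mu P e * div (flux P (depth (US e j))) x).
have c1 : S1 e @[e --> 0^'+] --> \sum_(j < s | (j < i)%N) ex_mx M i j *: (0 : R).
  exact: cvg_lincomb.
have c2 : S2 e @[e --> 0^'+] --> \sum_(j < s | (j <= i)%N) im_mx M i j *:
    (1 * div (flux P (depth (US0 j))) x).
  exact: cvg_lincomb.
pose l1 := \sum_(j < s | (j < i)%N) ex_mx M i j *: (0 : R).
pose l2 := \sum_(j < s | (j <= i)%N) im_mx M i j *: (1 * div (flux P (depth (US0 j))) x).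
have lE : depth Un0 x + dt *: l1 + dt *: l2 = depth Un0 x
    + dt * \sum_(j < s | (j <= i)%N) im_mx M i j * div (flux P (depth (US0 j))) x.
  rewrite /l1 big1 ?scaler0 ?addr0 => [|j _]; last by rewrite scaler0.
  by congr (_ + _ * _); apply: eq_bigr => j _; rewrite mul1r.
have c3 : depth (Un e) x + dt *: S1 e + dt *: S2 e @[e --> 0^'+] -->
    depth Un0 x + dt *: l1 + dt *: l2.
  by apply: cvgD; [apply: cvgD => //|]; exact: cvgZl_tmp.
rewrite -lE; apply: cvg_trans c3; apply: near_eq_cvg.
apply: filterS HS => e /(_ x Dx)[/(_ i) E _].
by have := congr1 fst E; rewrite /= !fst_sum => <-.
Qed.

(** * Asymptotic accuracy *)

Lemma bigO_pair (R : realType) (V W : normedModType R) n (u : R -> V * W) :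
  bigO_pow n (fun t => (u t).1) -> bigO_pow n (fun t => (u t).2) -> bigO_pow n u.
Proof.
move=> /bigO_pow_gt0[C C0 uC] /bigO_pow_gt0[C' C'0 vC]; exists (C + C'); near=> t.
have t0 : 0 <= t ^+ n by rewrite exprn_ge0// ltW.
have u1 : `|(u t).1| <= C * t ^+ n by near: t.
have u2 : `|(u t).2| <= C' * t ^+ n by near: t.
rewrite prod_normE ge_max mulrDl; apply/andP; split.
  by rewrite (le_trans u1)// lerDl mulr_ge0// ltW.
by rewrite (le_trans u2)// lerDr mulr_ge0// ltW.
Unshelve. all: by end_near. Qed.

Lemma bigO_row (R : realType) m n (u : R -> 'rV[R]_m) :
  (forall i, bigO_pow n (fun t => u t 0 i)) -> bigO_pow n u.
Proof.
move=> Hu; apply: (eq_near_bigO (u := fun t => \sum_(i < m) u t 0 i *: delta_mx 0 i)).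
  by apply: nearW => t; rewrite -row_sum_delta.
apply: bigO_sum => i _; have [C0 HC] := Hu i; exists (C0 * `|delta_mx 0 i : 'rV[R]_m|).
apply: filterS HC => t; rewrite normrZ mulrAC => HC.
by rewrite ler_wpM2r.
Qed.

Lemma div_near0 (R : realType) d (v : 'rV[R]_d -> 'rV[R]_d) x :
  (\forall y \near x, v y = 0) -> div v x = 0.
Proof.
move=> v0; rewrite /div big1// => i _.
rewrite (@near_eq_derive _ _ _ _ (cst 0)) ?derive_cst//.
by apply: filterS v0 => y ->; rewrite mxE.
Qed.

Lemma flux_grad0 (R : realType) d (P : swe_data R d) (h : 'rV[R]_d -> R) x :
  grad (surface P h) x = 0 -> flux P h x = 0.
Proof. by move=> g0; rewrite /flux g0 !scaler0. Qed.

(** The last stage omits only the diagonal entry of the explicit row, which is 0, and nothing of the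
    implicit row. *)
Lemma gsa_last_stage (R : realType) s (M : imex_tableau R s.+1) (E : lmodType R)
    (dt : R) (y0 : E) (Y FY GY : 'I_s.+1 -> E) (y1 : E) :
  explicit_part M -> globally_stiffly_accurate M ->
  imex_step M dt y0 Y FY GY y1 -> y1 = Y ord_max.
Proof.
move=> eM [wE wI] [-> ->]; rewrite wE wI; congr (_ + _ *: _ + _ *: _).
  rewrite [RHS]big_mkcond; apply: eq_bigr => j _; rewrite !mxE.
  by case: ltnP => // /eM ->; rewrite scale0r.
by apply: eq_big => [j|j _]; rewrite ?mxE// leq_ord.
Qed.

Theorem theorem3p2 (R : realType) (d : nat) (P : swe_data R d)
    (D : set 'rV[R]_d) (s p : nat) (M : imex_tableau R s.+1)
    (Un : R -> state R d) (Un0 : state R d)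
    (US : R -> R -> 'I_s.+1 -> state R d) (US0 : R -> 'I_s.+1 -> state R d)
    (U1 : R -> R -> state R d) (U10 : R -> state R d)
    (T : R) (Uexa : R -> state R d) :
  0 < grav P -> 0 < mann P -> 0 < dx P ->
  open D -> smooth_on D (bot P) ->
  explicit_part M -> diagonally_implicit M -> imex_order M p ->
  globally_stiffly_accurate M ->
  smooth_on D (depth Un0) -> (forall x, D x -> 0 < depth Un0 x) ->
  well_prepared P D Un Un0 ->
  (\forall dt \near 0^'+, \forall e \near 0^'+, forall x, D x ->
     imex_step M dt (Un e x) (fun i => US dt e i x)
       (fun i => swe_F P e (US dt e i) x) (fun i => swe_G P e (US dt e i) x)
       (U1 dt e x)) ->
  (\forall dt \near 0^'+,
     (forall i, chapman_enskog P D (fun e => US dt e i) (US0 dt i)) /\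
     chapman_enskog P D (U1 dt) (U10 dt)) ->
  (forall i, \forall dt \near 0^'+, smooth_on D (depth (US0 dt i))) ->
  (forall i, smooth_cvg_on D (fun dt => depth (US0 dt i)) (depth Un0)) ->
  0 < T -> limit_solution P D T (depth Un0) Uexa ->
  forall x, D x ->
    smooth_flux_at P (depth Un0) (fun dt i => depth (US0 dt i))
      (fun t => depth (Uexa t)) x ->
    exists L : R -> R * 'rV[R]_d,
      (\forall dt \near 0^'+, U1 dt e x @[e --> 0^'+] --> L dt) /\
      bigO_pow p.+1 (fun dt => L dt - Uexa dt x).
Proof.
move=> g0 k0 dx0 oD sb eM dM oM gM sh0 h00 wp HS CE shS chS T0 [sF regE Dh [_ che] qexa] x Dx Hx.
pose hS dt i := depth (US0 dt i).
pose hexa t := depth (Uexa t).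
have nq : \forall dt \near (0 : R)^'+, forall i y, D y ->
    momentum (US0 dt i) y = - flux P (hS dt i) y.
  apply: filterS3 (nbhs_right_gt (0 : R)) HS CE => dt dt0 HSdt [CEdt _] i y Dy.
  exact: (limit_momentum i g0 k0 oD sb dM dt0 Dy wp HSdt CEdt).
have nh : \forall dt \near (0 : R)^'+, forall i y, D y -> hS dt i y = depth Un0 y
    + dt * \sum_(j < s.+1 | (j <= i)%N) im_mx M i j * div (flux P (hS dt j)) y.
  apply: filterS3 nq HS CE => dt qdt HSdt [CEdt _] i y Dy.
  exact: (limit_depth i oD qdt Dy wp HSdt CEdt).
have nT : \forall t \near (0 : R)^'+, 0 < t < T.
  by near=> t; apply/andP; split => //; near: t; exact: nbhs_right_lt.
(* For small [e] the update is the last stage, so it converges to the leading term of that stage. *)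
exists (fun dt => US0 dt ord_max x); split.
  apply: filterS2 HS CE => dt HSdt [/(_ ord_max) CEdt _].
  apply: cvg_trans (chapman_enskog_cvg CEdt Dx); apply: near_eq_cvg.
  by apply: filterS HSdt => e /(_ x Dx); move/(gsa_last_stage eM gM).
(* Either the flux is smooth at the initial jets and the jet argument applies, or the limiting
   stages and the exact solution are at rest around [x]. *)
have [gx|rest] := Hx.
  have Gx := flux_domain_init k0 sb sh0 (h00 x Dx) gx Dx.
  have order w : bigO_pow p.+1 (fun dt => jet (hS dt ord_max) w x - jet (hexa dt) w x).
    exact: (limit_scheme_order w oM dM gM.2 oD sb sh0 Gx shS chS nh T0 sF Dh che).
  apply: bigO_pair; first exact: (order [::]).
  apply: bigO_row => i.
  (* Both momenta are minus the flux of their depth, an expression in jets of order at most one, so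
     the order of the depth jets carries over. *)
  have fluxO : bigO_pow p.+1 (fun dt => eeval (flux_expr P i) (jet_env (hexa dt) (bot P) x)
      - eeval (flux_expr P i) (jet_env (hS dt ord_max) (bot P) x)).
    apply: (eval_bigO (r0 := jet_env (depth Un0) (bot P) x) _ _ _ (Gx.2 i) (evars_flux P i)).
    - by case=> -[] w; rewrite /jet_env /=; [exact: cvg_cst|exact: che].
    - by case=> -[] w; rewrite /jet_env /=; [exact: cvg_cst|exact: (chS ord_max)].
    - case=> -[] w _; last exact: bigOBC (order w).
      by apply: near0_bigO; apply: nearW => t; rewrite /jet_env/= subrr.
  apply: eq_near_bigO fluxO; near=> dt.
  have dtT : 0 < dt < T by near: dt.
  have qdt : momentum (US0 dt ord_max) x = - flux P (hS dt ord_max) x.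
    by apply: (near nq dt).
  have shdt : smooth_on D (hS dt ord_max) by near: dt; exact: shS.
  have she : smooth_on D (hexa dt) by exact: (@smooth_on_slice R d T D hexa dt).
  have dtT' : 0 <= dt < T by have /andP[/ltW -> ->] := dtT.
  have db : differentiable (bot P) x by exact: (sb [::]).
  rewrite -!flux_eval//; [|exact: (shdt [::])|exact: (she [::])].
  rewrite -[RHS]/((momentum (US0 dt ord_max) x - momentum (Uexa dt) x) 0 i).
  by rewrite qdt qexa// !mxE opprK addrC.
(* At rest every flux vanishes around [x], hence so does its divergence, and the last stage keeps
   the initial depth. *)
have dS0 : \forall dt \near (0 : R)^'+, hS dt ord_max x = depth Un0 x.
  apply: filterS2 nh rest => dt -> // Hdt.
  rewrite big1 ?mulr0 ?addr0// => j _; rewrite div_near0 ?mulr0//.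
  by apply: filterS Hdt => y [/(_ j) + _]; exact: flux_grad0.
apply: bigO_pair.
  apply: (eq_near_bigO (u := fun dt => - (hexa dt x - depth Un0 x))).
    by apply: filterS dS0 => dt Edt; rewrite opprB -Edt.
  (* The exact depth at [x] has zero time derivative for small positive times and tends to its
     initial value. *)
  apply: bigON; apply: (@bigO_derive R p _ (fun=> 0)); last by apply: near0_bigO;
    exact: nearW.
    rewrite -[X in _ --> X](subrr (depth Un0 x)); apply: cvgB; last exact: cvg_cst.
    exact: (che [::]).
  apply: filterS2 nT rest => t tT Ht.
  rewrite -[X in is_derive _ _ _ X](subrr (0 : R)); apply: is_deriveB.
  rewrite -(@div_near0 R d (flux P (hexa t)) x); first exact: Dh.
  by apply: filterS Ht => y [_]; exact: flux_grad0.
apply: near0_bigO; near=> dt.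
have dtT : 0 < dt < T by near: dt.
have dtT' : 0 <= dt < T by have /andP[/ltW -> ->] := dtT.
have Hdt : \forall y \near x, (forall i, grad (surface P (hS dt i)) y = 0) /\
    grad (surface P (hexa dt)) y = 0 by near: dt.
have [g1 g2] := nbhs_singleton Hdt.
rewrite -[LHS]/(momentum (US0 dt ord_max) x - momentum (Uexa dt) x).
have -> : momentum (US0 dt ord_max) x = - flux P (hS dt ord_max) x.
  by apply: (near nq dt).
by rewrite qexa// !flux_grad0// subrr.
Unshelve. all: by end_near. Qed.
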